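(* There exists a maximum value of the function $\tau \mapsto h_\tau$ $(\tau \in A_0)$, and any maximum point of the function $\tau \mapsto h_\tau$ on $A_0$ belongs to the boundary $\partial A_0$ of $A_0$. In particular, $\max\{h_\tau : \tau \in A_0\} = \max\{h_\tau : \tau \in \partial A_0\}$.
   Context: $\mathbb{N}$ denotes the set of positive integers. Let $A_0 := \{ \tau = u+iv \in \mathbb{C} : u \ge 0,\ v \ge 1\}$, with boundary $\partial A_0$ taken in $\mathbb{C}$. Let $X := \{ z \in \mathbb{C} : |z - 1/2| \le 1/2\}$. For $\tau \in A_0$ let $I_\tau := \{ m + n\tau : m,n \in \mathbb{N}\}$, and let $S_\tau := \{\phi_b : X \to X \mid b \in I_\tau\}$, where $\phi_b(z) := \frac{1}{z+b}$ for $z \in X$ (these maps do send $X$ into $X$ and are uniformly contracting). $\{S_\tau\}_{\tau\in A_0}$ is called the family of CIFSs (conformal iterated function systems) of generalized complex continued fractions. For an infinite word $w = w_1w_2\cdots \in I_\tau^{\mathbb{N}}$ put $w|_n := w_1\cdots w_n$ and $\phi_{w|_n} := \phi_{w_1}\circ\cdots\circ\phi_{w_n}$; the set $\bigcap_{n\in\mathbb{N}} \phi_{w|_n}(X)$ is a singleton. The limit set of $S_\tau$ is $J_\tau := \bigcup_{w \in I_\tau^{\mathbb{N}}} \bigcap_{n\in\mathbb{N}} \phi_{w|_n}(X)$, and $h_\tau := \dim_{\mathcal{H}} J_\tau$ is its Hausdorff dimension (with respect to the Euclidean metric). *)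

(* Defs.v *)
From HB Require Import structures.
From mathcomp Require Import all_boot all_order all_algebra.
From mathcomp Require Import all_classical all_reals all_analysis.
From mathcomp Require Export complex.

Set Implicit Arguments.
Unset Strict Implicit.
Unset Printing Implicit Defensive.

Import Order.TTheory GRing.Theory Num.Theory.
Import numFieldNormedType.Exports.

Local Open Scope classical_set_scope.
Local Open Scope ring_scope.

(* The complex plane is R[i]; [normc] is the modulus with values in R.  The
   library puts the (Euclidean) topology on the alias R[i]^o, with balls
   [`|x - y| < e], where the norm and the radius e live in R[i]. *)
Notation normc := ComplexField.Normc.normc.

Definition boundary (R : realType) (A : set R[i]^o) : set R[i]^o :=
  closure A `\` interior A.

Section HausdorffDimension.
Variable R : realType.
Implicit Types (A : set R[i]) (U : nat -> set R[i]) (s d : R).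
Local Open Scope ereal_scope.

(* The value 0 is adjoined so that the empty set has diameter 0. *)
Definition diam A : \bar R :=
  ereal_sup (0 |` [set (normc (p.1 - p.2))%:E | p in A `*` A]).

(* For s = 0 a nonempty set has weight 1 and the empty set has weight 0. *)
Definition hweight s A : \bar R := if A == set0 then 0 else diam A `^ s.

Definition hausdorff_premeasure s d A : \bar R :=
  ereal_inf [set \sum_(k <oo) hweight s (U k) | U in
    [set U | (forall k, diam (U k) <= d%:E) /\ A `<=` \bigcup_k U k]].

Definition hausdorff_measure s A : \bar R :=
  ereal_sup [set hausdorff_premeasure s d A | d in [set d | (0 < d)%R]].

Definition hausdorff_dim A : \bar R :=
  ereal_inf [set s%:E | s in [set s | (0 <= s)%R /\ hausdorff_measure s A = 0]].

End HausdorffDimension.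

Section ComplexContinuedFractions.
Variable R : realType.
Implicit Types (tau b z : R[i]) (w : nat -> R[i]).

Definition A0 : set R[i] :=
  [set tau | 0 <= complex.Re tau /\ 1 <= complex.Im tau].

Definition X : set R[i] := [set z | normc (z - 2^-1) <= 2^-1].

Definition Iset tau : set R[i] :=
  [set b | exists m n : nat,
    [/\ (0 < m)%N, (0 < n)%N & b = m%:R + n%:R * tau]].

(* For tau in A0 and b in Iset tau, the denominator does not vanish on X. *)
Definition phi b z : R[i] := 1 / (z + b).

(* [phi_prefix w n] is phi_{w_1} \o ... \o phi_{w_n}; since words are indexed
   from 0 here, the letter w_k is [w k.-1]. *)
Fixpoint phi_prefix w (n : nat) : R[i] -> R[i] :=
  if n is n'.+1 then phi_prefix w n' \o phi (w n') else id.

Definition J tau : set R[i] :=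
  \bigcup_(w in [set w | forall k, Iset tau (w k)])
    \bigcap_(n in [set n | (0 < n)%N]) (phi_prefix w n @` X).

Definition h tau : \bar R := hausdorff_dim (J tau).

End ComplexContinuedFractions.

Arguments A0 {R}.

Definition is_max_point (T : Type) (R : realType) (f : T -> \bar R) (A : set T)
    (x : T) : Prop :=
  A x /\ forall y, A y -> (f y <= f x)%E.

Definition is_max (R : realType) (S : set (\bar R)) (M : \bar R) : Prop :=
  S M /\ ubound S M.

(* Main.v *)
(* For a finite word w over the alphabet, -ell(w) denotes log |phi_w'(0)|, and
   Z_n(tau, s) is the sum of exp (- s ell(w)) over the words of length n (here,
   over finite boxes of letters, uniformly in the box).  Bounded distortion
   gives a constant 10 such that Z_n(s) exp (10 s) < 1 for some n forces
   h <= s, by covering with cylinders, and Z_n(s) >= exp (10 s) for some n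
   forces h >= s, because the limit points of a finite subalphabet are
   separated.

   Moving tau changes ell(w) by at most 24 |w| |tau - tau'|, so h is uniformly
   continuous; it exceeds 1 at tau = i, and its upper limit at infinity is at
   most 1.  Hence a maximum M > 1 exists.

   If h = M at an interior point c, then h(c + r) = M as soon as the disc of
   radius 2 r about c lies in A0: exp (ell(w) / 2) is the modulus of a
   polynomial in tau of degree at most |w| with no zero in that disc, so the
   average of ell(w) over the N-th roots of r^N about c exceeds its value at c
   by at most 2 |w| / (N 2^N).  By convexity of exp, a drop of the growth rate of
   Z_n at c + r, which has weight 1 / N, would beat this error for N large,
   contradicting the growth at c.  Iterating, h = M at c + k r for all k,
   against the limit at infinity. *)
Require Import Defs.
From mathcomp Require Import all_boot all_order all_algebra.
From mathcomp Require Import all_classical all_reals all_analysis.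
From mathcomp Require Import ring lra.
Import numFieldNormedType.Exports.

Set Implicit Arguments.
Unset Strict Implicit.
Unset Printing Implicit Defensive.

Import Order.TTheory GRing.Theory Num.Theory.
Import ComplexField.Normc.

Local Open Scope classical_set_scope.
Local Open Scope ring_scope.

(** * Moduli of complex numbers and the disc X *)

Section Moduli.
Variable R : realType.
Implicit Types (x y z b : R[i]) (a : R).

Local Notation Re := complex.Re.
Local Notation Im := complex.Im.

Lemma ReD x y : Re (x + y) = Re x + Re y. Proof. by case: x; case: y. Qed.
Lemma ImD x y : Im (x + y) = Im x + Im y. Proof. by case: x; case: y. Qed.
Lemma ReN x : Re (- x) = - Re x. Proof. by case: x. Qed.
Lemma ImN x : Im (- x) = - Im x. Proof. by case: x. Qed.
Lemma ReM x y : Re (x * y) = Re x * Re y - Im x * Im y.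
Proof. by case: x; case: y. Qed.
Lemma ImM x y : Im (x * y) = Re x * Im y + Im x * Re y.
Proof. by case: x => ? ?; case: y => ? ? /=. Qed.
Lemma Re_nat n : Re (n%:R : R[i]) = n%:R.
Proof. by elim: n => [//|n IH]; rewrite -!natr1 ReD IH. Qed.
Lemma Im_nat n : Im (n%:R : R[i]) = 0.
Proof. by elim: n => [//|n IH]; rewrite -natr1 ImD IH /= addr0. Qed.
Lemma Re_inv x : Re x^-1 = Re x / (Re x ^+ 2 + Im x ^+ 2).
Proof. by case: x. Qed.
Lemma Im_inv x : Im x^-1 = - Im x / (Re x ^+ 2 + Im x ^+ 2).
Proof. by case: x => a b /=; rewrite mulNr. Qed.

Definition ReImE := (ReD, ImD, ReN, ImN, ReM, ImM, Re_nat, Im_nat).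

Lemma normc_ge0 x : 0 <= normc x.
Proof. by case: x => a b; rewrite sqrtr_ge0. Qed.

Lemma sqr_normcE x : normc x ^+ 2 = Re x ^+ 2 + Im x ^+ 2.
Proof. by case: x => a b; rewrite /= sqr_sqrtr // addr_ge0 ?sqr_ge0. Qed.

Lemma normc_leE x a : 0 <= a -> (normc x <= a) = (Re x ^+ 2 + Im x ^+ 2 <= a ^+ 2).
Proof. by move=> a0; rewrite -sqr_normcE ler_pXn2r // nnegrE normc_ge0. Qed.

Lemma normc_geE x a : 0 <= a -> (a <= normc x) = (a ^+ 2 <= Re x ^+ 2 + Im x ^+ 2).
Proof. by move=> a0; rewrite -sqr_normcE ler_pXn2r // nnegrE normc_ge0. Qed.

Lemma normc_distC x y : normc (x - y) = normc (y - x).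
Proof. by rewrite -opprB normcN. Qed.

Lemma normc_subD x y z : normc (x - z) <= normc (x - y) + normc (y - z).
Proof. by rewrite -[x - z](subrKA y) le_normcD. Qed.

Lemma normc_le_add x y : normc x <= normc y + normc (x - y).
Proof. by rewrite -{1}[x](subrK y) addrC; apply: le_normcD. Qed.

Lemma ge_Re_normc x : Re x <= normc x.
Proof.
have [h|h] := lerP 0 (Re x); last exact: le_trans (ltW h) (normc_ge0 x).
by rewrite normc_geE // lerDl sqr_ge0.
Qed.

Lemma ler_normRe x : `|Re x| <= normc x.
Proof. by rewrite normc_geE // -normrX ger0_norm ?sqr_ge0// lerDl sqr_ge0. Qed.

Lemma ler_normIm x : `|Im x| <= normc x.
Proof. by rewrite normc_geE // -normrX ger0_norm ?sqr_ge0// lerDr sqr_ge0. Qed.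

Lemma normc_gt0 x : (0 < normc x) = (x != 0).
Proof.
rewrite lt_neqAle normc_ge0 andbT eq_sym; congr negb.
apply/eqP/eqP => [/eq0_normc //|->]; exact: normc0.
Qed.

Lemma normcX x n : normc (x ^+ n) = normc x ^+ n.
Proof. by elim: n => [|n IH]; rewrite ?normc1 // !exprS normcM IH. Qed.

Lemma normc_0 : normc (0 : R[i]) = 0. Proof. exact: normc0. Qed.

Lemma normc_nat n : normc (n%:R : R[i]) = n%:R.
Proof. by rewrite normcMn (normc1 R). Qed.

Lemma normc_real a : normc a%:C%C = `|a|.
Proof. by rewrite /= expr0n /= addr0 sqrtr_sqr. Qed.

Lemma inX z : X z <-> Re z ^+ 2 + Im z ^+ 2 <= Re z.
Proof.
rewrite /X /= normc_leE ?invr_ge0 // !ReImE Re_inv Im_inv !Re_nat !Im_nat.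
rewrite expr0n /= addr0 oppr0 mul0r oppr0 addr0.
have -> : (2%:R : R) / 2 ^+ 2 = 2^-1 by field.
split=> h; nra.
Qed.

Lemma X0 : X (0 : R[i]).
Proof. by apply/inX; rewrite /= !expr0n /= addr0. Qed.

Lemma X_bounds z : X z -> [/\ 0 <= Re z, Re z <= 1, - 2^-1 <= Im z & Im z <= 2^-1].
Proof.
move/inX; set u := Re z; set v := Im z => h.
have := sqr_ge0 v; have := sqr_ge0 (u - 2^-1).
by split; nra.
Qed.

Lemma diamX z w : X z -> X w -> normc (z - w) <= 1.
Proof.
rewrite /X /= => hz hw; rewrite (le_trans (normc_subD _ 2^-1 _)) // (normc_distC _ w).
by have := lerD hz hw; rewrite (_ : 2^-1 + 2^-1 = 1); last field.
Qed.

Lemma phi_norm_sub b z z' : z + b != 0 -> z' + b != 0 ->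
  normc (phi b z - phi b z') * (normc (b + z) * normc (b + z')) = normc (z - z').
Proof.
move=> h h'; rewrite -!normcM (normc_distC z) /phi; congr normc.
rewrite !(addrC b); field.
by rewrite h h'.
Qed.

(** With u = b + z, the point 1/u lies in the disc because |1/u|^2 = 1/|u|^2 <= Re u / |u|^2 = Re
    (1/u). *)
Lemma phi_in_X b z : 1 <= Re (b + z) -> X (phi b z).
Proof.
rewrite addrC => h; apply/inX; rewrite /phi div1r Re_inv Im_inv.
move: (Re _) (Im _) h => u v h.
have p : 0 < u ^+ 2 + v ^+ 2 by rewrite ltr_wpDr ?sqr_ge0 ?exprn_gt0 // (lt_le_trans _ h).
have -> : (u / (u ^+ 2 + v ^+ 2)) ^+ 2 + (- v / (u ^+ 2 + v ^+ 2)) ^+ 2 = 1 / (u ^+ 2 + v ^+ 2).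
  by field; apply: lt0r_neq0.
by rewrite ler_pM2r ?invr_gt0.
Qed.

End Moduli.

(** * Words, derivatives and distortion *)

Section Words.
Variable R : realType.
Implicit Types (x y z b tau : R[i]) (p : nat * nat) (w u v : seq (nat * nat)).

Local Notation Re := complex.Re.
Local Notation Im := complex.Im.

(* Digits are indexed from 0: [p] stands for (p.1 + 1) + (p.2 + 1) tau. *)
Definition digit tau p : R[i] := p.1.+1%:R + p.2.+1%:R * tau.

Definition phiw tau w z : R[i] := foldr (fun p => phi (digit tau p)) z w.

(* [- ell tau w z] is the logarithm of the modulus of the derivative of
   [phiw tau w] at [z]. *)
Fixpoint ell tau w z : R :=
  if w is p :: w' then 2 * ln (normc (digit tau p + phiw tau w' z)) + ell tau w' z
  else 0.

Lemma digit_Iset tau p : Iset tau (digit tau p).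
Proof. by exists p.1.+1, p.2.+1. Qed.

Lemma phiw_cat tau u v z : phiw tau (u ++ v) z = phiw tau u (phiw tau v z).
Proof. by rewrite /phiw foldr_cat. Qed.

Lemma ell_cat tau u v z : ell tau (u ++ v) z = ell tau u (phiw tau v z) + ell tau v z.
Proof. by elim: u => [|p u IH] /=; rewrite ?add0r // IH phiw_cat addrA. Qed.

Section Bounds.
Variables (tau x : R[i]) (p : nat * nat).
Hypotheses (tauA : A0 tau) (xX : X x).
Local Notation D := (normc (digit tau p + x)).

Lemma digit_Re : p.1.+1%:R + p.2.+1%:R * Re tau <= Re (digit tau p + x).
Proof.
by rewrite !ReImE mul0r subr0 lerDl; case: (X_bounds xX).
Qed.

Lemma digit_Im : p.2.+1%:R * Im tau - 2^-1 <= Im (digit tau p + x).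
Proof.
by rewrite !ReImE mul0r add0r addr0 lerD2l; case: (X_bounds xX).
Qed.

Lemma digit_Re1 : 1 <= Re (digit tau p + x).
Proof.
apply: le_trans digit_Re; case: tauA => u0 _.
by rewrite -[leLHS]addr0 lerD ?mulr_ge0 // ler1n.
Qed.

Lemma digit_Im_nat : p.2.+1%:R - 2^-1 <= Im (digit tau p + x).
Proof.
apply: le_trans digit_Im; case: tauA => _ v1.
by rewrite lerD2r ler_peMr.
Qed.

Lemma digit_sqr_ge : 1 + (p.2.+1%:R - 2^-1) ^+ 2 <= D ^+ 2.
Proof.
rewrite sqr_normcE; have h1 := digit_Re1; have h2 := digit_Im_nat.
have n1 : (1 : R) <= p.2.+1%:R by rewrite ler1n.
by rewrite lerD // -?[leLHS](expr1n _ 2%N) lerXn2r ?nnegrE //; lra.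
Qed.

(** The worst case of [digit_sqr_ge] is n = 1. This constant gives the uniform contraction ratio
    4/5. *)
Lemma digit_sqr_ge54 : 5 / 4 <= D ^+ 2.
Proof.
apply: le_trans digit_sqr_ge; have n1 : (1 : R) <= p.2.+1%:R by rewrite ler1n.
nra.
Qed.

Lemma digit_sqr_ge_nat : p.2.+1%:R <= D ^+ 2.
Proof.
apply: le_trans digit_sqr_ge; move: (p.2.+1%:R : R) => n.
have := sqr_ge0 (n - 1); nra.
Qed.

Lemma digit_ge1 : 1 <= D.
Proof.
have := digit_sqr_ge54; have := normc_ge0 (digit tau p + x).
by move: D => d; nra.
Qed.

Lemma digit_gt0 : 0 < D. Proof. exact: lt_le_trans digit_ge1. Qed.

Lemma digit_neq0 : x + digit tau p != 0.
Proof. by rewrite addrC -normc_gt0 digit_gt0. Qed.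

Lemma digit_ge_half : p.2.+1%:R / 2 <= D.
Proof.
apply: le_trans (le_trans (ler_norm _) (ler_normIm _)).
apply: le_trans digit_Im_nat; have n1 : (1 : R) <= p.2.+1%:R by rewrite ler1n.
lra.
Qed.

(** AM-GM, once D^2 is known to be at least (m^2 + n^2 |tau|^2) / 2. The product form lets sums over
    digits split into two one-variable sums. *)
Lemma digit_sqr_ge_norm : p.1.+1%:R * p.2.+1%:R * normc tau <= D ^+ 2.
Proof.
have h : p.1.+1%:R ^+ 2 / 2 + p.2.+1%:R ^+ 2 * normc tau ^+ 2 / 2 <= D ^+ 2.
  rewrite !sqr_normcE; case: tauA => u0 v1.
  have := digit_Re; have := digit_Im.
  have n1 : (1 : R) <= p.2.+1%:R by rewrite ler1n.
  have m1 : (1 : R) <= p.1.+1%:R by rewrite ler1n.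
  move: (Re (_ + _)) (Im (_ + _)) (p.2.+1%:R : R) (p.1.+1%:R : R) n1 m1 u0 v1.
  move=> a b n m n1 m1; move: (Re tau) (Im tau) => u v u0 v1 hb ha.
  have nu : 0 <= n * u by rewrite mulr_ge0 // (le_trans _ n1).
  have nv : 1 <= n * v by rewrite -[leLHS]mulr1 ler_pM.
  have ha2 : (m + n * u) ^+ 2 <= a ^+ 2 by rewrite lerXn2r ?nnegrE //; lra.
  have hb2 : (n * v - 2^-1) ^+ 2 <= b ^+ 2 by rewrite lerXn2r ?nnegrE //; lra.
  apply: le_trans (lerD ha2 hb2).
  rewrite mulrDr -!exprMn; move: (n * u) (n * v) nu nv => U V U0 V1.
  (* (V - 1/2)^2 = V^2/2 + (V - 1)^2/2 - 1/4, and the loss 1/4 is absorbed by m^2/2. *)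
  have := sqr_ge0 (V - 1); have : 1 <= m ^+ 2 by rewrite exprn_ege1.
  have := sqr_ge0 U; have : 0 <= m * U by rewrite mulr_ge0 //; lra.
  nra.
apply: le_trans h; rewrite -mulrA.
have := sqr_ge0 (p.1.+1%:R - p.2.+1%:R * normc tau); lra.
Qed.

Lemma phi_digit_X : X (phi (digit tau p) x).
Proof. exact: phi_in_X digit_Re1. Qed.

End Bounds.

(** * Contraction, bounded distortion and dependence on the parameter *)

Lemma phiw_X tau w z : A0 tau -> X z -> X (phiw tau w z).
Proof. by move=> tA zX; elim: w => [//|p w IH]; apply: phi_digit_X. Qed.

Lemma ln_sub_le (a b : R) : 0 < a -> 0 < b -> ln a - ln b <= (a - b) / b.
Proof.
move=> a0 b0; rewrite -ln_div ?posrE //.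
rewrite mulrBl divff ?gt_eqF // -[X in ln X](subrKC 1).
by rewrite le_ln1Dx // ltrBrDl subrr divr_gt0.
Qed.

Lemma lnd_ge (tau x : R[i]) p : A0 tau -> X x ->
  5^-1 <= 2 * ln (normc (digit tau p + x)).
Proof.
move=> tA xX; rewrite mulr_natl -lnXn ?digit_gt0 //.
apply: (@le_trans _ _ (ln (5 / 4))); last first.
  by rewrite ler_ln ?posrE ?exprn_gt0 ?digit_gt0 // digit_sqr_ge54.
(* This reads ln (5/4) >= 1 - 4/5. *)
have := @ln_sub_le 1 (5/4) ltr01.
rewrite ln1 sub0r => /(_ _); lra.
Qed.

Lemma ell_ge tau w z : A0 tau -> X z -> (size w)%:R / 5 <= ell tau w z.
Proof.
move=> tA zX; elim: w => [|p w IH] /=; first by rewrite mul0r.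
by rewrite -natr1 mulrDl mul1r addrC lerD // lnd_ge //; apply: phiw_X.
Qed.

Lemma ell_ge0 tau w z : A0 tau -> X z -> 0 <= ell tau w z.
Proof. by move=> tA zX; apply: le_trans (ell_ge w tA zX); rewrite mulr_ge0. Qed.

(** Moebius maps satisfy the exact identity |f z - f z'|^2 = |z - z'|^2 |f' z| |f' z'|, which
    composes along the word. *)
Lemma phiw_dist tau w z z' : A0 tau -> X z -> X z' ->
  normc (phiw tau w z - phiw tau w z') =
  normc (z - z') * expR (- ((ell tau w z + ell tau w z') / 2)).
Proof.
move=> tA zX zX'; elim: w => [|p w IH] /=.
  by rewrite addr0 mul0r oppr0 expR0 mulr1.
have h := phiw_X w tA zX; have h' := phiw_X w tA zX'.
have d0 := digit_gt0 p tA h; have d0' := digit_gt0 p tA h'.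
have := phi_norm_sub (digit_neq0 p tA h) (digit_neq0 p tA h').
rewrite IH => /(canRL (mulfK _)) ->; last by rewrite mulf_neq0 ?gt_eqF.
rewrite -mulrA; congr (_ * _).
rewrite -{1}(lnK d0) -{1}(lnK d0') -expRD -expRN -expRD.
by congr expR; field.
Qed.

Lemma phiw_contract tau w z z' : A0 tau -> X z -> X z' ->
  normc (phiw tau w z - phiw tau w z') <= (4 / 5) ^+ size w.
Proof.
move=> tA zX zX'; elim: w => [|p w IH] /=; first by rewrite diamX.
have h := phiw_X w tA zX; have h' := phiw_X w tA zX'.
have d0 := digit_sqr_ge54 p tA h; have d0' := digit_sqr_ge54 p tA h'.
have e0 := digit_gt0 p tA h; have e0' := digit_gt0 p tA h'.
have := phi_norm_sub (digit_neq0 p tA h) (digit_neq0 p tA h').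
rewrite exprS; move: IH; move: (_ ^+ size w) => c.
have hd : 5 / 4 <= normc (digit tau p + phiw tau w z) * normc (digit tau p + phiw tau w z').
  rewrite -(@ler_pXn2r _ 2) ?nnegrE ?mulr_ge0 ?normc_ge0 // [leRHS]exprMn.
  by rewrite expr2 ler_pM.
have := normc_ge0 (phi (digit tau p) (phiw tau w z) - phi (digit tau p) (phiw tau w z')).
move: hd; move: (normc (phiw _ _ _ - _)) (normc (phi _ _ - _)) (normc _ * normc _) => F E D hD E0 hF hE.
nra.
Qed.

Lemma ell_distortion tau w z z' : A0 tau -> X z -> X z' ->
  ell tau w z - ell tau w z' <= 10.
Proof.
move=> tA zX zX'.
(* A letter followed by k others contributes at most 2 (4/5)^k, by [phiw_contract]; the geometric
   series sums to 2 / (1 - 4/5) = 10. *)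
suff : ell tau w z - ell tau w z' <= 10 * (1 - (4 / 5) ^+ size w).
  move/le_trans; apply; have : 0 <= (4 / 5 : R) ^+ size w by rewrite exprn_ge0 // divr_ge0.
  lra.
elim: w => [|p w IH] /=; first by rewrite subrr expr0 subrr mulr0.
have h := phiw_X w tA zX; have h' := phiw_X w tA zX'.
have d0 := digit_gt0 p tA h; have d1 := digit_ge1 p tA h'.
have d0' := digit_gt0 p tA h'.
have := ln_sub_le d0 d0'.
have : (normc (digit tau p + phiw tau w z) - normc (digit tau p + phiw tau w z')) /
   normc (digit tau p + phiw tau w z') <= (4 / 5) ^+ size w.
  rewrite ler_pdivrMr // (@le_trans _ _ ((4 / 5) ^+ size w)) ?ler_peMr ?exprn_ge0 ?divr_ge0 //.
  rewrite (le_trans _ (phiw_contract w tA zX zX')) //.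
  rewrite lerBlDl (le_trans (normc_le_add _ (digit tau p + phiw tau w z'))) //.
  by rewrite lerD2l opprD addrACA subrr add0r.
rewrite exprS; lra.
Qed.

(** The cocycle identity [ell_cat] evaluates [u] at [phiw tau v 0]; distortion moves this base point
    back to 0. *)
Lemma ell_catl tau u v : A0 tau -> ell tau (u ++ v) 0 <= ell tau u 0 + ell tau v 0 + 10.
Proof.
move=> tA; rewrite ell_cat -addrA (addrC _ 10) addrA lerD2r addrC -lerBlDr.
by apply: ell_distortion => //; [apply: phiw_X => //|]; apply: X0.
Qed.

Lemma ell_catr tau u v : A0 tau -> ell tau u 0 + ell tau v 0 - 10 <= ell tau (u ++ v) 0.
Proof.
move=> tA; rewrite ell_cat addrAC lerD2r lerBlDr addrC -lerBlDr.
by apply: ell_distortion => //; [|apply: phiw_X => //]; apply: X0.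
Qed.

Lemma phiw_lip tau w z z' : A0 tau -> X z -> X z' ->
  normc (phiw tau w z - phiw tau w z') <= normc (z - z') * expR (10 - ell tau w 0).
Proof.
move=> tA zX zX'; rewrite phiw_dist // ler_wpM2l ?normc_ge0 // ler_expR.
have := ell_distortion w tA (@X0 R) zX; have := ell_distortion w tA (@X0 R) zX'; lra.
Qed.

Lemma phiw_lip_lower tau w z z' : A0 tau -> X z -> X z' ->
  normc (z - z') * expR (- 10 - ell tau w 0) <= normc (phiw tau w z - phiw tau w z').
Proof.
move=> tA zX zX'; rewrite phiw_dist // ler_wpM2l ?normc_ge0 // ler_expR.
have := ell_distortion w tA zX (@X0 R); have := ell_distortion w tA zX' (@X0 R); lra.
Qed.

(** With n = p.2 + 1, prefixing [p] turns an error d into at most (n |tau - tau'| + d) / (D D'),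
    where D D' is at least both n and 5/4; the bound d <= 5 |tau - tau'| is thus preserved. *)
Lemma phiw_param tau tau' w : A0 tau -> A0 tau' ->
  normc (phiw tau w 0 - phiw tau' w 0) <= 5 * normc (tau - tau').
Proof.
move=> tA tA'; elim: w => [|p w IH].
  rewrite (_ : phiw tau [::] 0 = 0) // (_ : phiw tau' [::] 0 = 0) // subrr normc_0.
  by rewrite mulr_ge0 ?normc_ge0.
rewrite /=.
have h := phiw_X w tA (@X0 R); have h' := phiw_X w tA' (@X0 R).
have d0 := digit_sqr_ge54 p tA h; have d0' := digit_sqr_ge54 p tA' h'.
have n0 := digit_sqr_ge_nat p tA h; have n0' := digit_sqr_ge_nat p tA' h'.
have e0 := digit_gt0 p tA h; have e0' := digit_gt0 p tA' h'.
set D := normc (digit tau p + _) in d0 n0 e0 *.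
set D' := normc (digit tau' p + _) in d0' n0' e0' *.
have hd : 5 / 4 <= D * D'.
  rewrite -(@ler_pXn2r _ 2) ?nnegrE ?mulr_ge0 ?normc_ge0 // [leRHS]exprMn.
  by rewrite expr2 ler_pM.
have hn : p.2.+1%:R <= D * D'.
  rewrite -(@ler_pXn2r _ 2) ?nnegrE ?mulr_ge0 ?normc_ge0 // [leRHS]exprMn.
  by rewrite expr2 ler_pM.
have E : normc (phi (digit tau p) (phiw tau w 0) - phi (digit tau' p) (phiw tau' w 0)) * (D * D')
   = normc ((digit tau p + phiw tau w 0) - (digit tau' p + phiw tau' w 0)).
  rewrite -!normcM (normc_distC (digit tau p + _)) /phi; congr normc.
  rewrite !(addrC (digit _ _)); field.
  by rewrite (digit_neq0 p tA h) (digit_neq0 p tA' h').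
rewrite -(@ler_pM2r _ (D * D')) ?mulr_gt0 // E.
have : normc ((digit tau p + phiw tau w 0) - (digit tau' p + phiw tau' w 0)) <=
   p.2.+1%:R * normc (tau - tau') + normc (phiw tau w 0 - phiw tau' w 0).
  rewrite (_ : _ - _ = p.2.+1%:R * (tau - tau') + (phiw tau w 0 - phiw tau' w 0)).
    by rewrite (le_trans (le_normcD _ _)) // lerD2r normcM normc_nat.
  by rewrite /digit; ring.
move: IH (normc_ge0 (tau - tau')) hn hd; move: (normc _) (normc _) (normc _) (p.2.+1%:R : R) (D * D').
move=> a b c n d; nra.
Qed.

(** Each denominator moves by at most (n + 5) |tau - tau'| and has modulus at least n/2, a relative
    change of at most 12 |tau - tau'|; its logarithm counts twice in [ell]. *)
Lemma ell_param tau tau' w : A0 tau -> A0 tau' ->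
  ell tau w 0 - ell tau' w 0 <= 24 * (size w)%:R * normc (tau - tau').
Proof.
move=> tA tA'; elim: w => [|p w IH] /=; first by rewrite subrr mulr0 mul0r.
have h := phiw_X w tA (@X0 R); have h' := phiw_X w tA' (@X0 R).
have e0 := digit_gt0 p tA h; have e0' := digit_gt0 p tA' h'.
have hh := digit_ge_half p tA' h'.
have := ln_sub_le e0 e0'.
have : (normc (digit tau p + phiw tau w 0) - normc (digit tau' p + phiw tau' w 0)) /
   normc (digit tau' p + phiw tau' w 0) <= 12 * normc (tau - tau').
  rewrite ler_pdivrMr // lerBlDl (le_trans (normc_le_add _ (digit tau' p + phiw tau' w 0))) //.
  rewrite lerD2l.
  have : normc ((digit tau p + phiw tau w 0) - (digit tau' p + phiw tau' w 0)) <=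
     p.2.+1%:R * normc (tau - tau') + normc (phiw tau w 0 - phiw tau' w 0).
    rewrite (_ : _ - _ = p.2.+1%:R * (tau - tau') + (phiw tau w 0 - phiw tau' w 0)).
      by rewrite (le_trans (le_normcD _ _)) // lerD2r normcM normc_nat.
    by rewrite /digit; ring.
  have n1 : (1 : R) <= p.2.+1%:R by rewrite ler1n.
  move: (phiw_param w tA tA') (normc_ge0 (tau - tau')) n1 hh.
  move: (normc _) (normc _) (normc _) (p.2.+1%:R : R) (normc _) => a b c n d; nra.
rewrite -[(size w).+1]addn1 natrD mulrDr mulrDl mulr1; lra.
Qed.

End Words.

(** * Partition sums *)

Section PartitionSums.
Variable R : realType.
Implicit Types (z tau : R[i]) (s t g : R) (w u v : seq (nat * nat)) (A : seq (nat * nat)).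

Definition box L : seq (nat * nat) := [seq (i, j) | i <- iota 0 L, j <- iota 0 L].

Fixpoint words A n : seq (seq (nat * nat)) :=
  if n is n'.+1 then [seq p :: w | p <- A, w <- words A n'] else [:: [::]].

Lemma box_uniq L : uniq (box L).
Proof. by apply: allpairs_uniq; rewrite ?iota_uniq // => -[? ?] [? ?]. Qed.

Lemma mem_box L p : (p \in box L) = (p.1 < L)%N && (p.2 < L)%N.
Proof.
apply/allpairsP/andP => [[[i j] /= []]|[h1 h2]].
  by rewrite !mem_iota !add0n => /= h1 h2 ->.
by exists p; rewrite !mem_iota !add0n; split=> //; case: p {h1 h2}.
Qed.

Lemma mem_words A n w : (w \in words A n) = (size w == n) && all (mem A) w.
Proof.
elim: n w => [|n IH] w /=.
  by rewrite inE -size_eq0; case: eqP => // /size0nil ->.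
apply/allpairsP/andP => [[[p u] /= []]|[]].
  by rewrite IH => pA /andP[/eqP sz au] ->; rewrite /= sz eqxx pA.
case: w => [//|p u] /=; rewrite eqSS => sz /andP[pA au].
by exists (p, u); rewrite IH sz.
Qed.

Lemma sum_words_S A n (F : seq (nat * nat) -> R) :
  \sum_(w <- words A n.+1) F w = \sum_(p <- A) \sum_(w <- words A n) F (p :: w).
Proof. by rewrite /= big_allpairs_dep. Qed.

Lemma sum_words_cat A m n (F : seq (nat * nat) -> R) :
  \sum_(w <- words A (m + n)) F w =
  \sum_(u <- words A m) \sum_(v <- words A n) F (u ++ v).
Proof.
elim: m F => [|m IH] F; first by rewrite add0n big_seq1.
rewrite addSn !sum_words_S; apply: eq_bigr => p _.
by rewrite IH; apply: eq_bigr.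
Qed.

Definition Z tau L n s : R := \sum_(w <- words (box L) n) expR (- (s * ell tau w 0)).

Lemma Z_ge0 tau L n s : 0 <= Z tau L n s.
Proof. by apply: sumr_ge0 => w _; apply: expR_ge0. Qed.

Lemma size_words A n w : w \in words A n -> size w = n.
Proof. by rewrite mem_words => /andP[/eqP]. Qed.

Lemma ler_sum_words A n (F G : seq (nat * nat) -> R) :
  (forall w, size w = n -> F w <= G w) ->
  \sum_(w <- words A n) F w <= \sum_(w <- words A n) G w.
Proof.
move=> h; rewrite big_seq [leRHS]big_seq.
by apply: ler_sum => w /size_words; apply: h.
Qed.

Lemma Z_shift tau L n s t : A0 tau -> 0 <= t ->
  Z tau L n (s + t) <= expR (- (n%:R * t / 5)) * Z tau L n s.
Proof.
move=> tA t0; rewrite /Z mulr_sumr; apply: ler_sum_words => w sw.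
rewrite -expRD ler_expR; have := ell_ge w tA (@X0 R); rewrite sw.
move: (ell _ _ _) (n%:R : R) => a b; nra.
Qed.

Lemma Z_param tau tau' L n s : A0 tau -> A0 tau' -> 0 <= s ->
  Z tau' L n s <= expR (24 * n%:R * normc (tau - tau') * s) * Z tau L n s.
Proof.
move=> tA tA' s0; rewrite /Z mulr_sumr; apply: ler_sum_words => w sw.
rewrite -expRD ler_expR; have := ell_param w tA tA'; rewrite sw.
move: (_ * normc _) (ell _ _ _) (ell _ _ _) => a b c; nra.
Qed.

(** Words with [ell] at least the cut-off g are charged to the exponent s0, the others to s1. *)
Lemma Z_interpolate tau L n s0 s s1 g : s0 <= s -> s <= s1 ->
  Z tau L n s <= expR (- (g * (s - s0))) * Z tau L n s0
               + expR (g * (s1 - s)) * Z tau L n s1.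
Proof.
move=> h0 h1; rewrite /Z !mulr_sumr -big_split /=; apply: ler_sum => w _.
rewrite -!expRD; move: (ell _ _ _) => l.
have [h|h] := lerP g l.
  rewrite ler_wpDr ?expR_ge0 // ler_expR; nra.
rewrite ler_wpDl ?expR_ge0 // ler_expR; nra.
Qed.

Lemma Z_iter tau L n s C j : A0 tau -> 0 <= s -> Z tau L n s <= C ->
  Z tau L (n * j) s <= (C * expR (10 * s)) ^+ j.
Proof.
move=> tA s0 hC; have C0 : 0 <= C by apply: le_trans hC; apply: Z_ge0.
elim: j => [|j IH]; first by rewrite muln0 /Z big_seq1 /= mulr0 oppr0 expR0.
rewrite mulnS /Z sum_words_cat exprS.
apply: (@le_trans _ _ (expR (10 * s) * Z tau L n s * Z tau L (n * j) s)).
  rewrite [expR _ * _ * _]mulrC /Z mulr_sumr mulr_sumr.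
  apply: ler_sum => u _; rewrite mulr_suml.
  apply: ler_sum => v _; rewrite -!expRD ler_expR.
  have := ell_catr u v tA; move: (ell _ _ _) (ell _ _ _) (ell _ _ _) => a b c; nra.
by rewrite ler_pM ?Z_ge0 ?mulr_ge0 ?Z_ge0 ?expR_ge0 // mulrC ler_wpM2r ?expR_ge0.
Qed.

(** Discrete integral test: with t = s - 1, (k + 1)^(-s) <= (k^(-t) - (k + 1)^(-t)) / t, and the
    right-hand sides telescope. *)
Lemma zeta_bounded s : 1 < s ->
  exists a : R, forall L, \sum_(i <- iota 0 L) expR (- (s * ln i.+1%:R)) <= a.
Proof.
move=> s1; set t := s - 1; have t0 : 0 < t by rewrite subr_gt0.
exists (1 + t^-1) => -[|L].
  by rewrite big_nil addr_ge0 // invr_ge0 ltW.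
suff : \sum_(i <- iota 0 L.+1) expR (- (s * ln i.+1%:R)) <=
       1 + t^-1 * (1 - expR (- (t * ln L.+1%:R))) :> R.
  move/le_trans; apply; rewrite lerD2l -[leRHS]mulr1 ler_wpM2l ?invr_ge0 ?(ltW t0) //.
elim: L => [|L IH].
  by rewrite big_seq1 ln1 !mulr0 oppr0 expR0 subrr mulr0 addr0.
rewrite -addn1 iotaD big_cat big_seq1 add0n.
suff h : expR (- (s * ln L.+2%:R)) <=
   t^-1 * (expR (- (t * ln L.+1%:R)) - expR (- (t * ln L.+2%:R))) :> R.
  apply: le_trans (lerD IH h) _; rewrite addn1; lra.
have -> : expR (- (t * ln L.+1%:R)) =
   expR (- (t * ln L.+2%:R)) * expR (t * (ln L.+2%:R - ln L.+1%:R)) :> R.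
  by rewrite -expRD; congr expR; ring.
have -> : - (s * ln L.+2%:R) = - (t * ln L.+2%:R) + - ln L.+2%:R :> R.
  by rewrite /t; ring.
rewrite expRD [X in _ * X <= _]expRN lnK ?posrE //.
have d := @ln_sub_le R L.+1%:R L.+2%:R (ltr0Sn _ _) (ltr0Sn _ _).
have := expR_ge1Dx (t * (ln L.+2%:R - ln L.+1%:R) : R).
rewrite [_^-1 * _]mulrC ler_pdivlMr //.
have : L.+2%:R^-1 <= ln L.+2%:R - ln L.+1%:R :> R.
  move: d; rewrite -[L.+2]addn1 natrD opprD addrA subrr add0r mulN1r; lra.
have := expR_gt0 (- (t * ln L.+2%:R) : R).
move: (ln L.+2%:R - _) (L.+2%:R^-1) => d' c.
move: (expR (- _)) (expR (t * _)) => a b a0 h1 h2.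
have : t * c <= t * d' by rewrite ler_pM2l.
nra.
Qed.

(** By [digit_sqr_ge_norm] a digit contributes at most (m n |tau|)^(-s), whose sum over a box is
    |tau|^(-s) times the square of a partial zeta sum. The factor in |tau| controls the dimension at
    infinity. *)
Lemma Z_bounded s : 1 < s -> exists2 B, 0 < B & forall tau L n, A0 tau ->
  Z tau L n s <= (B * expR (- (s * ln (normc tau)))) ^+ n.
Proof.
move=> s1; have [z hz] := zeta_bounded s1.
exists ((z + 1) ^+ 2) => [|tau L n tA].
  have := hz 0; rewrite big_nil => z0; rewrite exprn_gt0 //; lra.
have z0 : 0 <= z by have := hz 0; rewrite big_nil.
have T1 : 1 <= normc tau.
  case: tA => _ h; exact: le_trans h (le_trans (ler_norm _) (ler_normIm _)).
elim: n => [|n IH]; first by rewrite /Z big_seq1 /= mulr0 oppr0 expR0.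
rewrite /Z sum_words_S exprS.
pose b p := expR (- (s * (ln p.1.+1%:R + ln p.2.+1%:R + ln (normc tau)))) : R.
apply: (@le_trans _ _ (\sum_(p <- box L) b p * Z tau L n s)).
  apply: ler_sum => p _; rewrite /Z mulr_sumr; apply: ler_sum => w _ /=.
  rewrite -expRD ler_expR -opprD lerN2 -mulrDr ler_pM2l ?(lt_trans ltr01) // lerD2r.
  have h := phiw_X w tA (@X0 R).
  rewrite mulr_natl -lnXn ?digit_gt0 // -!lnM ?posrE ?mulr_gt0 ?(lt_le_trans ltr01 T1) //.
  by rewrite ler_ln ?posrE ?exprn_gt0 ?digit_gt0 ?mulr_gt0 ?(lt_le_trans ltr01 T1) // digit_sqr_ge_norm.
rewrite -mulr_suml ler_pM ?Z_ge0 ?sumr_ge0 // => [p _|]; first exact: expR_ge0.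
have -> : \sum_(p <- box L) b p = (\sum_(i <- iota 0 L) expR (- (s * ln i.+1%:R))) ^+ 2
      * expR (- (s * ln (normc tau))).
  rewrite big_allpairs expr2 -mulrA mulr_suml; apply: eq_bigr => i _.
  rewrite mulr_suml mulr_sumr; apply: eq_bigr => j _.
  by rewrite /b -!expRD; congr expR => /=; ring.
rewrite ler_wpM2r ?expR_ge0 // lerXn2r ?nnegrE ?addr_ge0 ?sumr_ge0 //.
by apply: le_trans (hz L) _; rewrite lerDl.
Qed.

Lemma harmonic_square_unbounded C : exists L,
  C <= \sum_(p <- box L) (p.1.+1%:R ^+ 2 + p.2.+1%:R ^+ 2)^-1 :> R.
Proof.
suff h L : ln L.+1%:R / 2 <= \sum_(p <- box L) (p.1.+1%:R ^+ 2 + p.2.+1%:R ^+ 2)^-1 :> R.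
  exists (Num.trunc (expR (2 * C))); apply: le_trans (h _).
  rewrite ler_pdivlMr // mulrC -[leLHS]expRK ler_ln ?posrE ?expR_gt0 //.
  exact/ltW/truncnS_gt.
rewrite big_allpairs.
apply: (@le_trans _ _ (\sum_(i <- iota 0 L) (i.+1%:R^-1 / 2))).
  elim: L => [|L IH]; first by rewrite big_nil ln1 mul0r.
  rewrite -[X in iota _ X]addn1 iotaD big_cat big_seq1 add0n.
  apply: le_trans (lerD IH (lexx _)).
  have := @ln_sub_le R L.+2%:R L.+1%:R (ltr0Sn _ _) (ltr0Sn _ _).
  have -> : L.+2%:R - L.+1%:R = 1 :> R by rewrite -[L.+2]addn1 natrD addrAC subrr add0r.
  rewrite mul1r; move: (_^-1) (ln _) (ln _) => a b c; lra.
rewrite big_seq [leRHS]big_seq; apply: ler_sum => i; rewrite mem_iota add0n => /= iL.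
rewrite -(subnKC iL) iotaD big_cat; apply: ler_wpDr.
  by apply: sumr_ge0 => j _; rewrite invr_ge0 addr_ge0 ?sqr_ge0.
(* Row i keeps only its first i + 1 entries, each at least 1 / (2 (i + 1)^2), so the double sum
   dominates half the harmonic series. *)
apply: (@le_trans _ _ (\sum_(j <- iota 0 i.+1) (2 * i.+1%:R ^+ 2)^-1)).
  rewrite big_const_seq count_predT size_iota iter_addr addr0 -[leRHS]mulr_natl.
  rewrite le_eqVlt; apply/orP; left; apply/eqP; field.
  by rewrite nat1r pnatr_eq0.
rewrite big_seq [leRHS]big_seq; apply: ler_sum => j; rewrite mem_iota add0n => /= ji.
rewrite lef_pV2 ?posrE ?mulr_gt0 ?addr_gt0 ?exprn_gt0 //.
by rewrite mulr_natl mulr2n lerD2l lerXn2r ?nnegrE // ler_nat.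
Qed.

(** At tau = i the one-letter sum at exponent 1 is the divergent sum of 1 / (m^2 + n^2). A finite
    box makes it exceed exp 11, which leaves room to raise the exponent slightly above 1. *)
Lemma Z_large : exists s L, 
  [/\ 1 < s, A0 ((0 +i* 1)%C : R[i]) & expR (10 * s) <= Z (0 +i* 1)%C L 1 s].
Proof.
have [L hL] := harmonic_square_unbounded (expR 11).
have [M M0 hM] : exists2 M, 0 < M & forall p, p \in box L ->
    ln (p.1.+1%:R ^+ 2 + p.2.+1%:R ^+ 2) <= M :> R.
  exists (1 + ln (2 * L%:R ^+ 2)) => [|p].
    have [->|L0] := posnP L; first by rewrite expr0n /= mulr0 ln0 // addr0.
    have : 0 <= ln (2 * L%:R ^+ 2) :> R; last by lra.
    apply: ln_ge0; rewrite -[leLHS]mulr1 ler_pM ?ler1n //.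
    by rewrite exprn_ege1 // ler1n.
  rewrite mem_box => /andP[h1 h2]; rewrite ler_wpDl //.
  have L0 : (0 < L)%N by apply: leq_ltn_trans h1.
  rewrite ler_ln ?posrE ?addr_gt0 ?mulr_gt0 ?exprn_gt0 ?ltr0n //.
  by rewrite mulr_natl mulr2n lerD // lerXn2r ?nnegrE // ler_nat.
have tA : A0 ((0 +i* 1)%C : R[i]) by split => /=.
(* With e = 1 / (M + 10), raising the exponent by e costs a factor of at least exp (- e M), and 11 -
   e M = 10 (1 + e). *)
exists (1 + (M + 10)^-1), L; split=> //.
  by rewrite ltrDl invr_gt0 addr_gt0.
set e := (M + 10)^-1.
have e0 : 0 < e by rewrite invr_gt0 addr_gt0.
have eM : e * (M + 10) = 1 by rewrite mulVf // gt_eqF // addr_gt0.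
apply: (@le_trans _ _ (expR (- (e * M)) * expR 11)).
  by rewrite -expRD ler_expR; nra.
apply: le_trans (ler_wpM2l (expR_ge0 _) hL) _.
rewrite mulr_sumr /Z sum_words_S big_seq [leRHS]big_seq; apply: ler_sum => p pL.
rewrite big_seq1 /= addr0 addr0.
have h := digit_gt0 p tA (@X0 R); rewrite addr0 in h.
rewrite mulr_natl -lnXn // sqr_normcE /digit !ReImE /=.
rewrite !(mulr0, mulr1, mul0r, addr0, add0r, subr0).
have q0 : 0 < p.1.+1%:R ^+ 2 + p.2.+1%:R ^+ 2 :> R by rewrite addr_gt0 ?exprn_gt0.
rewrite -[X in _ * X^-1](lnK q0) -expRN -expRD ler_expR.
have := hM p pL; move: (ln _) => l; nra.
Qed.

End PartitionSums.

(** * Upper bound on the dimension *)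

Section UpperBound.
Variable R : realType.
Implicit Types (x z tau : R[i]) (s d : R) (A : set R[i]) (w : seq (nat * nat)).

Lemma expn_small (q e : R) : 0 <= q < 1 -> 0 < e ->
  exists N, forall j, (N <= j)%N -> q ^+ j <= e.
Proof.
move=> /andP[q0 q1] e0.
have : (GRing.exp q : nat -> R) @ \oo --> (0 : R) by apply: cvg_expr; rewrite ger0_norm.
move=> /cvgrPdist_le /(_ _ e0) [N _ hN]; exists N => j /hN /=.
by rewrite sub0r normrN ger0_norm // exprn_ge0.
Qed.

Lemma diam_ge0 A : (0 <= diam A)%E.
Proof. by apply: ereal_sup_ubound; left. Qed.

Lemma diam_le A d : 0 <= d -> (forall x y, A x -> A y -> normc (x - y) <= d) ->
  (diam A <= d%:E)%E.
Proof.
move=> d0 h; apply: ge_ereal_sup => _ [->|[[x y] [/= Ax Ay] <-]]; rewrite lee_fin //.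
exact: h.
Qed.

Lemma hweight_ge0 s A : (0 <= hweight s A)%E.
Proof. by rewrite /hweight; case: ifP => // _; apply: poweR_ge0. Qed.

Lemma hweight_le s A d : 0 <= s ->
  (diam A <= (expR d)%:E)%E -> (hweight s A <= (expR (s * d))%:E)%E.
Proof.
move=> s0 h; rewrite /hweight; case: ifP => _; first by rewrite lee_fin expR_ge0.
rewrite mulrC expRM -poweR_EFin; apply: gt0_ler_poweR => //.
  by rewrite in_itv /= leey diam_ge0.
by rewrite in_itv /= leey lee_fin expR_ge0.
Qed.

Lemma hausdorff_dim_le s A : 0 <= s ->
  (forall d e, 0 < d -> 0 < e -> exists U : nat -> set R[i],
    [/\ forall k, (diam (U k) <= d%:E)%E, A `<=` \bigcup_k U k &
        (\sum_(k <oo) hweight s (U k) <= e%:E)%E]) ->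
  (hausdorff_dim A <= s%:E)%E.
Proof.
move=> s0 h; apply: ereal_inf_lbound; exists s => //; split => //.
apply/eqP; rewrite eq_le; apply/andP; split.
  apply: ge_ereal_sup => _ [d d0 <-]; apply/lee_addgt0Pr => e e0.
  have [U [h1 h2 h3]] := h d e d0 e0; rewrite add0e; apply: le_trans h3.
  by apply: ereal_inf_lbound; exists U.
apply: ereal_sup_ge; exists (hausdorff_premeasure s 1 A); first by exists 1 => //=.
apply: le_ereal_inf_tmp => _ [U _ <-]; apply: nneseries_ge0 => k _ _.
exact: hweight_ge0.
Qed.

Lemma phiw_rcons tau w p z : phiw tau (rcons w p) z = phiw tau w (phi (digit tau p) z).
Proof. by rewrite /phiw foldr_rcons. Qed.

Lemma phi_prefix_digits tau (b : nat -> R[i]) (p : nat -> nat * nat) n z :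
  (forall k, b k = digit tau (p k)) -> phi_prefix b n z = phiw tau (mkseq p n) z.
Proof.
by move=> h; elim: n z => [//|n IH] z; rewrite mkseqS phiw_rcons -h -IH.
Qed.

Lemma J_digits tau x : J tau x -> exists p : nat -> nat * nat,
  forall n, (0 < n)%N -> exists2 z, X z & x = phiw tau (mkseq p n) z.
Proof.
move=> [b hb hx].
have /choice [p hp] : forall k, exists q : nat * nat, b k = digit tau q.
  move=> k; have [m [n [m0 n0 ->]]] := hb k.
  by exists (m.-1, n.-1); rewrite /digit /= !prednK.
exists p => n n0; have [z zX <-] := hx n n0.
by exists z => //; rewrite (phi_prefix_digits _ _ hp).
Qed.

Lemma ler_sum_uniq (T : eqType) (r r' : seq T) (F : T -> R) :
  uniq r -> uniq r' -> {subset r <= r'} -> (forall i, 0 <= F i) ->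
  \sum_(i <- r) F i <= \sum_(i <- r') F i.
Proof.
move=> ur ur' sub F0.
rewrite [leRHS](bigID (mem r)) /= -[\sum_(i <- r' | i \in r) _]big_filter.
have /(perm_big _) -> : perm_eq [seq i <- r' | i \in r] r; last by rewrite ler_wpDr ?sumr_ge0.
apply: uniq_perm; rewrite ?filter_uniq // => i.
by rewrite mem_filter; case: (boolP (i \in r)) => //= /sub ->.
Qed.

Lemma words_uniq (A : seq (nat * nat)) n : uniq A -> uniq (words A n).
Proof.
move=> uA; elim: n => [//|n IH] /=.
by apply: allpairs_uniq => // -[p u] [q v] _ _ [-> ->].
Qed.

(** A finite family of words uses finitely many digits, hence fits in a box; bounds uniform in the
    box then pass to the infinite alphabet. *)
Lemma sum_le_words (r : seq (seq (nat * nat))) N (F : seq (nat * nat) -> R) :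
  uniq r -> (forall w, w \in r -> size w = N) -> (forall w, 0 <= F w) ->
  exists L, \sum_(w <- r) F w <= \sum_(w <- words (box L) N) F w.
Proof.
move=> ur sz F0; pose m := \max_(p <- flatten r) maxn p.1 p.2.
exists m.+1; apply: ler_sum_uniq => //.
  by apply: words_uniq; apply: box_uniq.
move=> w wr; rewrite mem_words sz // eqxx /=; apply/allP => p pw.
rewrite /= mem_box !ltnS -geq_max.
apply: (@leq_bigmax_seq _ (flatten r) xpredT (fun p => maxn p.1 p.2)) => //.
by apply/flattenP; exists w.
Qed.

(** Words over the infinite alphabet are enumerated by their codes, each exactly once; all other
    indices carry the empty set, of weight 0. *)
Definition cylinder_cover tau N (k : nat) : set R[i] :=
  if pickle_inv k is Some w then if size w == N then phiw tau w @` @X R else set0 else set0.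

Lemma nneseries_le_bound (u : nat -> \bar R) (C : \bar R) :
  (forall k, 0 <= u k)%E -> (forall m, \sum_(0 <= k < m) u k <= C)%E ->
  (\sum_(k <oo) u k <= C)%E.
Proof.
by move=> u0 h; apply: lime_le; [apply: is_cvg_nneseries | apply: nearW].
Qed.

Lemma h_le tau s n C : A0 tau -> 0 <= s -> (0 < n)%N ->
  (forall L, Z tau L n s <= C) -> C * expR (10 * s) < 1 -> (h tau <= s%:E)%E.
Proof.
move=> tA s0 n0 hC hlt; apply: hausdorff_dim_le => // d e d0 e0.
set q := C * _ in hlt.
have q0 : 0 <= q by rewrite mulr_ge0 ?expR_ge0 // (le_trans _ (hC 0)) ?Z_ge0.
have [N1 h1] : exists N, forall j, (N <= j)%N -> q ^+ j <= e / expR (10 * s).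
  by apply: expn_small; rewrite ?q0 // divr_gt0 ?expR_gt0.
have [N2 h2] : exists N, forall j, (N <= j)%N -> expR (- 5^-1) ^+ j <= d / expR 10 :> R.
  apply: expn_small; first by rewrite expR_ge0 expR_lt1 ltrNl oppr0 invr_gt0 ltr0n.
  by rewrite divr_gt0 ?expR_gt0.
(* [N1] controls the total weight and [N2] the diameters; the successor keeps [N] positive, as
   [J_digits] requires. *)
pose j := (N1 + N2).+1; pose N := (n * j)%N.
have dia w : size w = N -> (diam (phiw tau w @` @X R) <= (expR (10 - ell tau w 0))%:E)%E.
  move=> sw; apply: diam_le; first exact: expR_ge0.
  move=> _ _ [z zX <-] [z' zX' <-]; apply: le_trans (phiw_lip w tA zX zX') _.
  by rewrite ler_piMl ?expR_ge0 // diamX.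
have diaU k : (diam (cylinder_cover tau N k) <= d%:E)%E.
  rewrite /cylinder_cover; case: pickle_inv => [w|]; last first.
    by apply: diam_le => //; exact: ltW.
  case: eqP => [sw|_]; last by apply: diam_le => //; exact: ltW.
  apply: le_trans (dia _ sw) _; rewrite lee_fin expRD.
  have : expR (- 5^-1) ^+ j <= d / expR 10 by apply: h2; rewrite /j ltnW // ltnS leq_addl.
  rewrite ler_pdivlMr ?expR_gt0 // mulrC; apply: le_trans.
  rewrite ler_pM2l ?expR_gt0 // -expRM_natl ler_expR mulrN lerN2.
  apply: le_trans (ell_ge w tA (@X0 R)); rewrite sw ler_pM2r ?invr_gt0 // ler_nat.
  by rewrite leq_pmull.
exists (cylinder_cover tau N); split => //.
  move=> x /J_digits [p hp].
  have [|z zX ->] := hp N; first by rewrite muln_gt0 n0.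
  exists (pickle (mkseq p N)) => //; rewrite /cylinder_cover pickleK_inv size_mkseq eqxx.
  by exists z.
apply: nneseries_le_bound => [k|m]; first exact: hweight_ge0.
pose F w := expR (s * (10 - ell tau w 0)).
pose g k := oapp (fun w => if size w == N then F w else 0) 0 (pickle_inv k).
have hg k : (hweight s (cylinder_cover tau N k) <= (g k)%:E)%E.
  rewrite /cylinder_cover /g; case: pickle_inv => [w|] /=; last by rewrite /hweight eqxx.
  case: eqP => [sw|_]; last by rewrite /hweight eqxx.
  by apply: hweight_le => //; apply: dia.
apply: (@le_trans _ _ (\sum_(0 <= k < m) (g k)%:E)%E); first exact: lee_sum.
rewrite sumEFin lee_fin.
have -> : \sum_(0 <= k < m) g k =
   \sum_(w <- [seq w <- pmap pickle_inv (index_iota 0 m) | size w == N]) F w.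
  by rewrite [RHS]big_filter [RHS]big_mkcond [RHS]big_pmap.
have [||w|L hL] := @sum_le_words [seq w <- pmap pickle_inv (index_iota 0 m) | size w == N] N F.
- by rewrite filter_uniq // (pmap_uniq (@pickle_invK _)) // iota_uniq.
- by move=> w; rewrite mem_filter => /andP[/eqP].
- exact: expR_ge0.
apply: le_trans hL _.
have -> : \sum_(w <- words (box L) N) F w = expR (10 * s) * Z tau L N s.
  rewrite /Z mulr_sumr; apply: eq_bigr => w _.
  by rewrite /F -expRD; congr expR; ring.
rewrite mulrC -ler_pdivlMr ?expR_gt0 //.
apply: le_trans (Z_iter _ tA s0 (hC L)) _.
by apply: h1; rewrite /j ltnW // ltnS leq_addr.
Qed.

End UpperBound.

(** * Limit points of finite subsystems *)

Section Greedy.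
Variables (R : realType) (T : eqType) (A : seq T) (c : seq T -> R) (W : nat -> seq T).
Hypotheses (Auniq : uniq A) (c_ge0 : forall v, 0 <= c v).
Hypothesis c_sub : forall v, c v <= \sum_(b <- A) c (rcons v b).

(** Total weight of the listed cylinders lying below [v]. *)
Let S v : \bar R := (\sum_(k <oo) (if prefix v (W k) then c (W k) else 0)%:E)%E.

Let S_term v k : (((if prefix v (W k) then c (W k) else 0)%:E : \bar R) <= S v)%E.
Proof.
apply: le_trans (nneseries_lim_ge k.+1 _) => [|i _ _]; last first.
  by rewrite lee_fin; case: ifP.
rewrite big_nat_recr //= leeDr // sume_ge0 // => i _.
by rewrite lee_fin; case: ifP.
Qed.

(** If every child b failed, then S v >= \sum_b S (rcons v b) >= \sum_b c (rcons v b) >= c v. *)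
Let S_step v : (S v < (c v)%:E)%E ->
  exists2 b, b \in A & (S (rcons v b) < (c (rcons v b))%:E)%E.
Proof.
move=> hv; apply: contrapT => hn; move: hv; apply/negP; rewrite -leNgt.
have hb b : b \in A -> ((c (rcons v b))%:E <= S (rcons v b))%E.
  by move=> bA; rewrite leNgt; apply/negP => hlt; apply: hn; exists b.
apply: (@le_trans _ _ (\sum_(b <- A) (c (rcons v b))%:E)%E).
  by rewrite sumEFin lee_fin.
apply: (@le_trans _ _ (\sum_(b <- A) S (rcons v b))%E).
  by rewrite big_seq [leRHS]big_seq; apply: lee_sum.
rewrite -nneseries_sum => [|b i _]; last by rewrite lee_fin; case: ifP.
apply: lee_nneseries => [i _ _|i _].
  by apply: sume_ge0 => b _; rewrite lee_fin; case: ifP.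
rewrite sumEFin lee_fin.
have pre b : prefix (rcons v b) (W i) -> prefix v (W i).
  by apply: prefix_trans; rewrite -cats1 prefix_prefix.
case: ifP => [_|hf]; last first.
  by rewrite big1 // => b _; case: ifP => // /pre; rewrite hf.
have pre2 b x : prefix (rcons v b) (W i) -> b = nth x (W i) (size v).
  move/prefixP => [u ->]; rewrite cat_rcons nth_cat ltnn subnn //.
(* At most one child of [v] is a prefix of [W i]: its letter is the entry of [W i] at position
   [size v]. The head of [A] serves as default for [nth]. *)
rewrite -big_mkcond /=; case: A Auniq => [_|x A' uA]; first by rewrite big_nil.
rewrite big_mkcond /= (le_trans (_ : _ <= \sum_(b <- x :: A' | b == nth x (W i) (size v)) c (W i))) //.
  rewrite [leRHS]big_mkcond; apply: ler_sum => b _.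
  by case: ifP => [/(pre2 _ x) <-|]; rewrite ?eqxx //; case: ifP.
case: (boolP (nth x (W i) (size v) \in x :: A')) => hin.
  rewrite big_mkcond (bigD1_seq _ hin uA) /= eqxx big1 ?addr0 // => b.
  by move=> /negbTE ->.
rewrite big_seq_cond big_pred0 // => b; apply/negbTE/negP => /andP[bA /eqP eb].
by move: hin; rewrite -eb bA.
Qed.

(* If the total weight of the cylinders [W k] is less than that of the whole
   space, one can descend forever while keeping the cylinders below the current
   prefix lighter than the prefix itself. *)
Lemma greedy_escape : (\sum_(k <oo) (c (W k))%:E < (c [::])%:E)%E ->
  exists om : nat -> T, (forall i, om i \in A) /\
    (forall k, W k <> mkseq om (size (W k))).
Proof.
move=> h0.
have S0 : (S [::] < (c [::])%:E)%E.
  by congr (_ < _)%E : h0; apply: eq_eseriesr => k _; rewrite prefix0s.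
have [b0 _ _] := S_step S0.
have /choice [next hnext] : forall v, exists b, (S v < (c v)%:E)%E ->
    b \in A /\ (S (rcons v b) < (c (rcons v b))%:E)%E.
  move=> v; have [/S_step [b bA hb]|hv] := pselect (S v < (c v)%:E)%E; first by exists b.
  by exists b0 => /hv.
pose V n := iter n (fun v => rcons v (next v)) [::].
have hV n : (S (V n) < (c (V n))%:E)%E.
  by elim: n => [//|n IH] /=; case: (hnext _ IH).
have EV n : V n = mkseq (next \o V) n.
  by elim: n => [//|n IH]; rewrite mkseqS -IH.
exists (next \o V); split => [i|k Ek]; first by case: (hnext _ (hV i)).
(* If the path ran through [W k], this word would itself count in the sum below its own prefix,
   contradicting the strict inequality. *)
have := hV (size (W k)); rewrite EV -Ek; apply/negP; rewrite -leNgt.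
by have := S_term (W k) k; rewrite prefix_refl.
Qed.

End Greedy.

(** * Points coded by infinite digit sequences, and their separation *)

Section LimitPoints.
Variable R : realType.
Implicit Types (x z tau : R[i]) (s d : R) (w : seq (nat * nat)) (p q : nat -> nat * nat).

(** The limit is the supremum of the lower bounds u n - e n, each of which is below every upper
    bound u m + e m; this keeps the rate explicit. *)
Lemma real_limit (u e : nat -> R) :
  (forall n m, (n <= m)%N -> `|u m - u n| <= e n) ->
  exists l, forall n, `|l - u n| <= e n.
Proof.
move=> h.
have e0 n : 0 <= e n by apply: le_trans (h n n (leqnn n)); rewrite normr_ge0.
have hnm n m : u n - e n <= u m + e m.
  have [nm|/ltnW mn] := leqP n m.
    by have := h _ _ nm; rewrite ler_distl => /andP[]; have := e0 m; lra.
  by have := h _ _ mn; rewrite ler_distl => /andP[]; have := e0 n; lra.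
pose E := range (fun n => u n - e n).
have supE : has_sup E.
  by split; [exists (u 0 - e 0), 0|exists (u 0 + e 0) => _ [n _ <-]].
exists (sup E) => n; rewrite ler_distl; apply/andP; split.
  by apply: ub_le_sup; [case: supE|exists n].
by apply: ge_sup => [|_ [m _ <-]]; [case: supE|].
Qed.

Lemma le_of_geometric (a b C : R) : 0 < C -> (forall n, a <= b + C * (4 / 5) ^+ n) -> a <= b.
Proof.
move=> C0 h; apply/ler_addgt0Pr => e e0.
have [N hN] : exists N, forall j, (N <= j)%N -> (4 / 5 : R) ^+ j <= e / C.
  by apply: expn_small; [apply/andP; split; lra|rewrite divr_gt0].
apply: le_trans (h N) _; rewrite lerD2l mulrC -ler_pdivlMr //; exact: hN.
Qed.

Lemma normc_le_sum x : normc x <= `|complex.Re x| + `|complex.Im x|.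
Proof.
rewrite normc_leE ?addr_ge0 // sqrrD !real_normK ?num_real //.
by rewrite -addrA lerD2l lerDr mulrn_wge0 // mulr_ge0.
Qed.

Definition shift n p : nat -> nat * nat := fun k => p (n + k)%N.

Lemma mkseq_shift p n m : mkseq p (n + m) = mkseq p n ++ mkseq (shift n p) m.
Proof.
rewrite /mkseq iotaD map_cat add0n -{2}[n]addn0 iotaDl -map_comp //.
Qed.

(** The factor 2 comes from taking the limits of real and imaginary parts separately. *)
Lemma exists_limit_point tau p : A0 tau ->
  exists x, X x /\ forall n, normc (x - phiw tau (mkseq p n) 0) <= 2 * (4 / 5) ^+ n.
Proof.
move=> tA; pose z n := phiw tau (mkseq p n) 0.
have zz n m : (n <= m)%N -> normc (z m - z n) <= (4 / 5) ^+ n.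
  move=> nm; rewrite /z -(subnKC nm) mkseq_shift phiw_cat.
  rewrite -[X in _ ^+ X](size_mkseq p n).
  by apply: phiw_contract => //; [apply: phiw_X => //|]; apply: X0.
have [a ha] : exists a, forall n, `|a - complex.Re (z n)| <= (4 / 5) ^+ n.
  apply: real_limit => n m nm; apply: le_trans (zz n m nm).
  by rewrite -ReN -ReD ler_normRe.
have [b hb] : exists b, forall n, `|b - complex.Im (z n)| <= (4 / 5) ^+ n.
  apply: real_limit => n m nm; apply: le_trans (zz n m nm).
  by rewrite -ImN -ImD ler_normIm.
have hx n : normc ((a +i* b)%C - z n) <= 2 * (4 / 5) ^+ n.
  by rewrite (le_trans (normc_le_sum _)) // !ReImE mulr_natl mulr2n lerD.
exists (a +i* b)%C; split => //; change (normc ((a +i* b)%C - 2^-1) <= 2^-1).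
apply: (@le_of_geometric _ _ 2) => // n.
apply: le_trans (normc_subD _ (z n) _) _; rewrite addrC lerD //.
by apply: phiw_X => //; apply: X0.
Qed.

Definition limpt tau p : R[i] :=
  xget 0 [set x | X x /\ forall n, normc (x - phiw tau (mkseq p n) 0) <= 2 * (4 / 5) ^+ n].

Section Limpt.
Variable tau : R[i].
Hypothesis tauA : A0 tau.
Local Notation pt := (limpt tau).

Lemma limptP p : X (pt p) /\
  forall n, normc (pt p - phiw tau (mkseq p n) 0) <= 2 * (4 / 5) ^+ n.
Proof. by rewrite /limpt; case: xgetP => // /(_ _) h; have [x /h] := exists_limit_point p tauA. Qed.

Lemma limptX p : X (pt p). Proof. by case: (limptP p). Qed.

(** Both sides are within 2 (4/5)^m of the image of 0 under the first n + m letters, for every m. *)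
Lemma limpt_shift p n : pt p = phiw tau (mkseq p n) (pt (shift n p)).
Proof.
apply/eqP; rewrite -subr_eq0; apply/eqP/eq0_normc/le_anti; rewrite normc_ge0 andbT.
apply: (@le_of_geometric _ _ 4) => // m; rewrite add0r.
apply: le_trans (normc_subD _ (phiw tau (mkseq p (n + m)) 0) _) _.
have <- : 2 * (4 / 5) ^+ m + 2 * (4 / 5) ^+ m = 4 * (4 / 5) ^+ m :> R by ring.
apply: lerD.
  have [_ /(_ (n + m)%N) h] := limptP p; apply: le_trans h _.
  rewrite ler_pM2l // exprD ler_piMl ?exprn_ge0 ?divr_ge0 // exprn_ile1 ?divr_ge0 //.
  lra.
rewrite mkseq_shift phiw_cat normc_distC.
have [hX /(_ m) h] := limptP (shift n p).
have zX : X (phiw tau (mkseq (shift n p) m) 0) by apply: phiw_X => //; apply: X0.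
rewrite phiw_dist //; apply: le_trans h; rewrite ler_piMr ?normc_ge0 // expR_le1.
have := ell_ge0 (mkseq p n) tauA hX; have := ell_ge0 (mkseq p n) tauA zX; lra.
Qed.

Lemma limpt_J p : J tau (pt p).
Proof.
exists (fun k => digit tau (p k)) => [k|n _]; first exact: digit_Iset.
exists (pt (shift n p)); first exact: limptX.
by rewrite (phi_prefix_digits _ _ (fun=> erefl)) -limpt_shift.
Qed.

Variable A : seq (nat * nat).
(** [M] bounds all denominators over the finite alphabet [A], and [e] is the distance kept from the
    boundary circle of X by points coded in [A]. *)
Let M : R := 2 + \sum_(b <- A) normc (digit tau b).
Let e : R := (M ^+ 4)^-1.

Let M2 : 2 <= M.
Proof. by rewrite lerDl sumr_ge0 // => b _; apply: normc_ge0. Qed.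

Let leM b x : b \in A -> X x -> normc (digit tau b + x) <= M.
Proof.
move=> bA xX; apply: le_trans (le_normcD _ _) _; rewrite addrC lerD //.
  have := diamX xX (@X0 R); rewrite subr0; lra.
rewrite (big_rem b) //= lerDl sumr_ge0 // => *; exact: normc_ge0.
Qed.

Let Re_phi b x : b \in A -> X x -> (M ^+ 2)^-1 <= complex.Re (phi (digit tau b) x).
Proof.
move=> bA xX; rewrite /phi div1r Re_inv -sqr_normcE [x + _]addrC.
have h1 := digit_Re1 b tauA xX; have h0 := digit_gt0 b tauA xX.
apply: (@le_trans _ _ (normc (digit tau b + x) ^+ 2)^-1).
  rewrite lef_pV2 ?posrE ?exprn_gt0 // ?(lt_le_trans _ M2) //.
  by rewrite lerXn2r ?nnegrE ?normc_ge0 ?leM // (le_trans _ M2).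
by rewrite ler_peMl // invr_ge0 exprn_ge0 // ltW.
Qed.

(** With u = digit + x, |1/u - 1/2|^2 = 1/4 - (Re u - 1) / |u|^2, where Re u - 1 >= Re x >= M^(-2)
    and |u| <= M. *)
Let phi_inner b x : b \in A -> X x -> (M ^+ 2)^-1 <= complex.Re x ->
  normc (phi (digit tau b) x - 2^-1) <= 2^-1 - e.
Proof.
move=> bA xX hx.
have M0 : 0 < M by apply: lt_le_trans M2.
have e1 : e <= 2^-1.
  rewrite /e lef_pV2 ?posrE ?exprn_gt0 // (le_trans M2) // -[leLHS]expr1.
  by rewrite ler_weXn2l // (le_trans _ M2) // ler1n.
have e0 : 0 < e by rewrite invr_gt0 exprn_gt0.
rewrite normc_leE ?subr_ge0 // /phi div1r !ReImE Re_inv Im_inv [x + _]addrC.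
rewrite (Re_inv 2) (Im_inv 2) !Re_nat !Im_nat.
have h0 := digit_gt0 b tauA xX.
have hM : normc (digit tau b + x) ^+ 2 <= M ^+ 2.
  by rewrite lerXn2r ?nnegrE ?normc_ge0 ?leM // ltW.
have h1 : (M ^+ 2)^-1 <= complex.Re (digit tau b + x) - 1.
  rewrite ReD; apply: le_trans hx _; have := digit_Re1 b tauA (@X0 R).
  rewrite addr0; lra.
have : 0 < normc (digit tau b + x) ^+ 2 by rewrite exprn_gt0.
rewrite sqr_normcE in hM *; move: (complex.Re _) (complex.Im _) hM h1 => u v hM h1 n0.
have -> : (u / (u ^+ 2 + v ^+ 2) - 2 / (2 ^+ 2 + 0 ^+ 2)) ^+ 2 +
   (- v / (u ^+ 2 + v ^+ 2) - - 0 / (2 ^+ 2 + 0 ^+ 2)) ^+ 2 = 4^-1 - (u - 1) / (u ^+ 2 + v ^+ 2).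
  field; apply: lt0r_neq0; exact: n0.
have : e <= (u - 1) / (u ^+ 2 + v ^+ 2).
  have -> : e = (M ^+ 2)^-1 * (M ^+ 2)^-1 by rewrite /e -invfM -exprD.
  apply: ler_pM; rewrite ?invr_ge0 ?exprn_ge0 ?(ltW M0) //.
  by rewrite lef_pV2 ?posrE // exprn_gt0.
nra.
Qed.

(** Two letters are used: the inner one moves the point off the imaginary axis, the outer one then
    moves it off the circle. *)
Let limpt_inner p : (forall i, p i \in A) -> normc (pt p - 2^-1) <= 2^-1 - e.
Proof.
move=> pA; rewrite (limpt_shift p 1) /=; apply: phi_inner => //; first exact: limptX.
rewrite (limpt_shift (shift 1 p) 1) /=; apply: Re_phi; [exact: pA|exact: limptX].
Qed.

Let digit_sep a b : a <> b -> 1 <= normc (digit tau a - digit tau b).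
Proof.
have aux (i j : nat) : i <> j -> 1 <= `|i.+1%:R - j.+1%:R| :> R.
  move=> ij; wlog lij : i j ij / (i < j)%N => [hw|].
    by case: (ltngtP i j) => // h; [|rewrite distrC]; apply: hw => //; apply/nesym.
  rewrite distrC -natrB; last exact: ltnW.
  by rewrite ger0_norm ?ler0n // ler1n subn_gt0.
case: a b => [a1 a2] [b1 b2] ab; have [_ v1] := tauA.
have [E|E] := pselect (a2 = b2).
  have n1 : a1 <> b1 by move=> E1; apply: ab; rewrite E E1.
  apply: le_trans (ler_normRe _); rewrite /digit E !ReImE /= opprD addrACA subrr addr0.
  exact: aux.
apply: le_trans (ler_normIm _); rewrite /digit !ReImE /= !mul0r !addr0 !add0r -mulrBl normrM.
by rewrite -[leLHS]mulr1 ler_pM ?aux // (le_trans v1) // ler_norm.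
Qed.

(** Distinct digits are at distance at least 1, so the translated discs may touch, but the coded
    points stay [e] inside and leave a gap 2 e. Inversion costs M^2, and the common prefix costs its
    derivative up to exp 10. *)
Lemma limpt_sep : exists2 dl : R, 0 < dl & forall p q n,
  (forall i, p i \in A) -> (forall i, q i \in A) ->
  mkseq p n = mkseq q n -> p n <> q n ->
  dl * expR (- ell tau (mkseq p n) 0) <= normc (pt p - pt q).
Proof.
have M0 : 0 < M by apply: lt_le_trans M2.
have e0 : 0 < e by rewrite invr_gt0 exprn_gt0.
exists (2 * e / M ^+ 2 * expR (- 10)).
  by rewrite mulr_gt0 ?expR_gt0 // divr_gt0 ?mulr_gt0 ?exprn_gt0.
move=> p q n pA qA E pq; rewrite (limpt_shift p n) (limpt_shift q n) -E.
apply: le_trans (phiw_lip_lower _ tauA (limptX _) (limptX _)).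
rewrite -mulrA -expRD ler_pM2r ?expR_gt0 //.
rewrite (limpt_shift (shift n p) 1) (limpt_shift (shift n q) 1) /=.
set x := pt (shift 1 (shift n p)); set y := pt (shift 1 (shift n q)).
rewrite /shift addn0.
have hx : normc (x - 2^-1) <= 2^-1 - e by apply: limpt_inner => i; apply: pA.
have hy : normc (y - 2^-1) <= 2^-1 - e by apply: limpt_inner => i; apply: qA.
have xX : X x := limptX _; have yX : X y := limptX _.
have dx := digit_gt0 (p n) tauA xX; have dy := digit_gt0 (q n) tauA yX.
have Eq : normc (phi (digit tau (p n)) x - phi (digit tau (q n)) y) *
   (normc (digit tau (p n) + x) * normc (digit tau (q n) + y))
   = normc ((digit tau (p n) + x) - (digit tau (q n) + y)).
  rewrite -!normcM (normc_distC (digit tau _ + _)) /phi; congr normc.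
  rewrite !(addrC (digit _ _)); field.
  by rewrite (digit_neq0 (p n) tauA xX) (digit_neq0 (q n) tauA yX).
rewrite ler_pdivrMr ?exprn_gt0 //.
apply: (@le_trans _ _ (normc ((digit tau (p n) + x) - (digit tau (q n) + y)))); last first.
  rewrite -Eq ler_wpM2l ?normc_ge0 // expr2.
  by rewrite ler_pM ?normc_ge0 // leM.
have := digit_sep pq.
have := normc_subD y 2^-1 x; rewrite (normc_distC 2^-1 x).
have := normc_le_add (digit tau (p n) - digit tau (q n)) (y - x).
rewrite (_ : _ - _ - (y - x) = (digit tau (p n) + x) - (digit tau (q n) + y)).
  lra.
by move: (digit _ _) (digit _ _) => a b; ring.
Qed.

End Limpt.
End LimitPoints.

(** * Lower bound on the dimension *)

Section LowerBound.
Variable R : realType.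
Implicit Types (x z : R[i]) (p : nat -> nat * nat) (v w : seq (nat * nat)).

Lemma hweight_ge (s d : R) (U : set R[i]) : 0 <= s -> U !=set0 ->
  ((expR d)%:E <= diam U)%E -> ((expR (s * d))%:E <= hweight s U)%E.
Proof.
move=> s0 /set0P U0 hd; rewrite /hweight (negbTE U0).
rewrite mulrC expRM -poweR_EFin; apply: gt0_ler_poweR => //.
  by rewrite in_itv /= leey lee_fin expR_ge0.
by rewrite in_itv /= leey (le_trans _ hd) // lee_fin expR_ge0.
Qed.

Lemma hweight_antitone (s t : R) (U : set R[i]) : 0 <= t -> t < s ->
  (diam U <= 1)%E -> (hweight s U <= hweight t U)%E.
Proof.
move=> t0 ts; rewrite /hweight; case: ifP => // _.
have := diam_ge0 U; case: (diam U) => [d| |] //.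
move=> d0 d1; rewrite !poweR_EFin lee_fin; rewrite !lee_fin in d0 d1.
have [->|dn0] := eqVneq d 0.
  by rewrite powR0 ?powR_ge0 // gt_eqF // (le_lt_trans t0).
apply: ger_powR; last exact: ltW.
by rewrite lt_neqAle eq_sym dn0 d0 d1.
Qed.

Lemma diam_ge (x y : R[i]) (U : set R[i]) : U x -> U y -> ((normc (x - y))%:E <= diam U)%E.
Proof. by move=> Ux Uy; apply: ereal_sup_ubound; right; exists (x, y). Qed.

Section Cover.
Variables (tau : R[i]) (L n : nat) (s : R).
Hypotheses (tauA : A0 tau) (n_gt0 : (0 < n)%N) (s_gt0 : 0 < s).
Hypothesis Z_ge : expR (10 * s) <= Z tau L n s.

Let A := box L.

(* Summing over the first n generations turns the n-step inequality [Z_ge] into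
   a one-step one: [wt v <= \sum_b wt (rcons v b)]. *)
Let wt v : R := \sum_(0 <= j < n) \sum_(u <- words A j) expR (- (s * ell tau (v ++ u) 0)).

Let wt_ge0 v : 0 <= wt v.
Proof. by apply: sumr_ge0 => j _; apply: sumr_ge0 => u _; apply: expR_ge0. Qed.

(** Passing to the children shifts the generations by one, so the two sides differ by a n - a 0,
    which is nonnegative by [Z_ge] and distortion. *)
Let wt_sub v : wt v <= \sum_(b <- A) wt (rcons v b).
Proof.
pose a j := \sum_(u <- words A j) expR (- (s * ell tau (v ++ u) 0)).
have -> : \sum_(b <- A) wt (rcons v b) = \sum_(0 <= j < n) a j.+1.
  rewrite exchange_big /=; apply: eq_bigr => j _.
  rewrite /a sum_words_S; apply: eq_bigr => b _; apply: eq_bigr => u _.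
  by rewrite cat_rcons.
have E : wt v + a n = a 0%N + \sum_(0 <= j < n) a j.+1.
  by rewrite -big_nat_recl // big_nat_recr.
have : a 0%N <= a n.
  rewrite /a /= big_seq1 cats0.
  apply: (@le_trans _ _ (expR (- (s * ell tau v 0)) * (expR (- (10 * s)) * Z tau L n s))).
    rewrite ler_peMr ?expR_ge0 //.
    by rewrite -(@ler_pM2l _ (expR (10 * s))) ?expR_gt0 // mulr1 mulrA -expRD subrr expR0 mul1r.
  rewrite /Z !mulr_sumr; apply: ler_sum => u _; rewrite -!expRD ler_expR.
  have := ler_wpM2l (ltW s_gt0) (ell_catl v u tauA).
  move: (ell _ _ _) (ell _ _ _) (ell _ _ _) => x y z; nra.
lra.
Qed.

Let C : R := \sum_(0 <= j < n) expR (10 * s) * Z tau L j s.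

Let C_gt0 : 0 < C.
Proof.
rewrite /C; case: n n_gt0 => [//|m] _; rewrite big_nat_recl //.
rewrite ltr_pwDl ?sumr_ge0 // => [|j _]; last by rewrite mulr_ge0 ?expR_ge0 ?Z_ge0.
by rewrite mulr_gt0 ?expR_gt0 // /Z big_seq1 expR_gt0.
Qed.

Let wt_le v : wt v <= C * expR (- (s * ell tau v 0)).
Proof.
rewrite /wt /C mulr_suml; apply: ler_sum => j _.
rewrite /Z mulr_sumr mulr_suml; apply: ler_sum => u _; rewrite -!expRD ler_expR.
have := ler_wpM2l (ltW s_gt0) (ell_catr v u tauA).
move: (ell _ _ _) (ell _ _ _) (ell _ _ _) => x y z; nra.
Qed.

Let wt_nil : 1 <= wt [::].
Proof.
rewrite /wt; case: n n_gt0 => [//|m] _; rewrite big_nat_recl // big_seq1 /=.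
rewrite mulr0 oppr0 expR0 lerDl sumr_ge0 // => j _.
by apply: sumr_ge0 => u _; apply: expR_ge0.
Qed.

Let wt_small (e : R) : 0 < e -> exists N, forall w, size w = N -> wt w <= e.
Proof.
move=> e0.
have [N hN] : exists N, forall j, (N <= j)%N -> expR (- (s / 5)) ^+ j <= e / C.
  apply: expn_small; last by rewrite divr_gt0.
  by rewrite expR_ge0 expR_lt1 ltrNl oppr0 divr_gt0.
exists N => w sw; apply: le_trans (wt_le w) _; rewrite mulrC -ler_pdivlMr //.
apply: le_trans (hN N (leqnn N)); rewrite -expRM_natl ler_expR mulrN lerN2.
have := ler_wpM2l (ltW s_gt0) (ell_ge w tauA (@X0 R)); rewrite sw.
move: (N%:R : R) (ell _ _ _) => a b; nra.
Qed.

Let Om p := forall i, p i \in A.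

(** A mass distribution argument without a measure: each U k gets a word [W k] that starts every
    coded sequence whose point is in U k, with weight controlled by that of U k. Too light a cover
    would let [greedy_escape] produce an uncovered point. *)
Lemma cover_lower_bound : exists2 eta : R, 0 < eta &
  forall U : nat -> set R[i], J tau `<=` \bigcup_k U k ->
    (eta%:E <= \sum_(k <oo) hweight s (U k))%E.
Proof.
have [dl dl0 hdl] := limpt_sep tauA A.
pose K := C * expR (- (s * ln dl)).
have K0 : 0 < K by rewrite mulr_gt0 ?expR_gt0.
(* Of the mass [wt [::]], at least 1, one half is budgeted for the sets U k and one half for the
   error terms, which sum to 1/2. *)
exists (2 * K)^-1 => [|U hU]; first by rewrite invr_gt0 mulr_gt0.
have /choice [W hW] : forall k, exists w,
    (forall p, Om p -> U k (limpt tau p) -> w = mkseq p (size w)) /\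
    ((wt w)%:E <= K%:E * hweight s (U k) + (2^-1 / (2 ^ k.+1)%:R)%:E)%E.
  move=> k; set e : R := _ / _.
  have e0 : 0 < e by rewrite divr_gt0 // ltr0n expn_gt0.
  have [N hN] := wt_small e0.
  have hle w : wt w <= e -> ((wt w)%:E <= K%:E * hweight s (U k) + e%:E)%E.
    move=> h; rewrite -[leLHS]add0e leeD ?lee_fin //.
    by rewrite mule_ge0 ?lee_fin ?hweight_ge0 // ltW.
  (* If no coded point lies in U k, any sufficiently long word will do. *)
  have [[p [pO pU]]|hno] := pselect (exists p, Om p /\ U k (limpt tau p)); last first.
    exists (nseq N (0%N, 0%N)); split; last by apply/hle/hN; rewrite size_nseq.
    by move=> p pO pU; exfalso; apply: hno; exists p.
  pose Q j := `[< exists q, [/\ Om q, U k (limpt tau q) & q j <> p j] >].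
  (* If only one coding sequence leads into U k, a long prefix of it has small enough weight. *)
  have [[j0 hj0]|hno] := pselect (exists j, Q j); last first.
    exists (mkseq p N); split; last by apply/hle/hN; rewrite size_mkseq.
    move=> q qO qU; rewrite size_mkseq; apply/eq_map => j.
    by apply: contrapT => h; apply: hno; exists j; apply/asboolP; exists q; split => // /esym.
  (* Otherwise cut at the first index where codings disagree: separation then bounds the diameter of
     U k from below. *)
  case: (ex_minnP (ex_intro _ j0 hj0 : exists j, Q j)) => j /asboolP [q [qO qU qp]] jmin.
  have agree q' : Om q' -> U k (limpt tau q') -> mkseq p j = mkseq q' j.
    move=> q'O q'U; apply/eq_in_map => i; rewrite mem_iota /= add0n => ij.
    apply: contrapT => h; have := jmin i; rewrite leqNgt ij => /(_ _)/notF; apply.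
    by apply/asboolP; exists q'; split => // /esym.
  exists (mkseq p j); split; first by move=> q' q'O q'U; rewrite size_mkseq; apply: agree.
  rewrite -[leLHS]adde0; apply: leeD; last by rewrite lee_fin ltW.
  have hd : ((expR (ln dl - ell tau (mkseq p j) 0))%:E <= diam (U k))%E.
    apply: le_trans (diam_ge pU qU); rewrite lee_fin expRD lnK ?posrE //.
    apply: hdl => //; [exact: agree|exact/nesym].
  have Une : U k !=set0 by exists (limpt tau p).
  have K0e : (0 <= K%:E)%E by rewrite lee_fin ltW.
  apply: le_trans (lee_wpmul2l K0e (hweight_ge (ltW s_gt0) Une hd)).
  rewrite -EFinM lee_fin; apply: le_trans (wt_le _) _.
  by rewrite /K -mulrA ler_pM2l // -expRD ler_expR; lra.
rewrite leNgt; apply/negP => hlt.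
have hsum : (\sum_(k <oo) (wt (W k))%:E < (wt [::])%:E)%E.
  apply: (@le_lt_trans _ _ (K%:E * \sum_(k <oo) hweight s (U k) + (2^-1)%:E)%E).
    rewrite -nneseriesZl => [|k _]; last exact: hweight_ge0.
    apply: le_trans (epsilon_trick _ _ _) => //.
      apply: lee_nneseries => [k _ _|k _]; first by rewrite lee_fin wt_ge0.
      by case: (hW k).
    by move=> k; rewrite mule_ge0 ?lee_fin ?hweight_ge0 // ltW.
  apply: (@lt_le_trans _ _ 1%:E); last by rewrite lee_fin.
  have : (K%:E * \sum_(k <oo) hweight s (U k) < K%:E * ((2 * K)^-1)%:E)%E.
    by rewrite lte_pmul2l // lte_fin.
  rewrite -EFinM invfM mulrCA divff ?gt_eqF // mulr1 => h.
  rewrite (_ : 1%E = (2^-1 + 2^-1 : R)%:E); last by congr EFin; field.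
  by rewrite EFinD lteD2rE.
have [om [omA hom]] := greedy_escape (@box_uniq L) wt_ge0 wt_sub hsum.
have [k _ hk] := hU _ (limpt_J tauA om).
by have [h _] := hW k; apply: (hom k); apply: h.
Qed.

Lemma h_ge : (s%:E <= h tau)%E.
Proof.
apply: le_ereal_inf_tmp => _ [t [t0 ht] <-]; rewrite lee_fin leNgt; apply/negP => ts.
have [eta eta0 heta] := cover_lower_bound.
have : (eta%:E <= hausdorff_measure t (J tau))%E.
  (* Mesh 1 suffices: for diameters at most 1, lowering the exponent from s to t can only increase
     the weights. *)
  apply: ereal_sup_ge; exists (hausdorff_premeasure t 1 (J tau)); first by exists 1 => /=.
  apply: le_ereal_inf_tmp => _ [U [hU1 hU2] <-]; apply: le_trans (heta U hU2) _.
  apply: lee_nneseries => [k _ _|k _]; first exact: hweight_ge0.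
  by apply: hweight_antitone.
by rewrite ht lee_fin leNgt eta0.
Qed.

End Cover.
End LowerBound.

(** * Mean value inequality in the parameter *)

Section MeanValue.
Variable R : realType.
Implicit Types (c z tau : R[i]) (w : seq (nat * nat)).

(* Numerator and denominator of [phiw tau w 0], as polynomials in [tau]. *)
Fixpoint convergent w : {poly R[i]} * {poly R[i]} :=
  if w is p :: w' then
    let: (P, Q) := convergent w' in
    (Q, (p.1.+1%:R%:P + p.2.+1%:R%:P * 'X) * Q + P)
  else (0, 1).

(** Prefixing a letter multiplies the denominator by [digit tau p + phiw tau w 0], exactly the
    factor whose logarithm enters [ell]. *)
Lemma convergentP tau w : A0 tau ->
  [/\ (convergent w).2.[tau] != 0,
      phiw tau w 0 = (convergent w).1.[tau] / (convergent w).2.[tau] &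
      normc (convergent w).2.[tau] = expR (ell tau w 0 / 2)].
Proof.
move=> tA; elim: w => [|p w] /=.
  rewrite !hornerE ?mul0r expR0.
  by split; rewrite ?oner_neq0 // (normc1 R).
have hX := phiw_X w tA (@X0 R).
case: (convergent w) => P Q /= [Q0 E N].
have := digit_gt0 p tA hX; have := digit_neq0 p tA hX; rewrite {}E => d0 dgt.
have E : ((p.1.+1%:R%:P + p.2.+1%:R%:P * 'X) * Q + P).[tau] =
    (P.[tau] / Q.[tau] + digit tau p) * Q.[tau].
  by rewrite hornerD hornerM hornerD hornerM hornerX !hornerC [RHS]mulrDl mulfVK // [RHS]addrC.
split.
- by rewrite E mulf_neq0.
- by rewrite E /phi invfM mulrCA divff // mulr1 div1r.
- rewrite E normcM N [P.[tau] / _ + _]addrC mulrDl expRD; congr (_ * _).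
  by rewrite mulrAC divff ?mul1r ?lnK // pnatr_eq0.
Qed.

Lemma size_convergent w :
  (size (convergent w).1 <= (size w).+1)%N /\ (size (convergent w).2 <= (size w).+1)%N.
Proof.
elim: w => [|p w].
  by split; [rewrite (_ : (convergent [::]).1 = 0) // size_poly0|apply: eq_leq (size_poly1 _)].
rewrite [convergent (p :: w)]/=.
case: (convergent w) => P Q /= [hP hQ]; split; first exact: leqW.
apply: leq_trans (size_polyD _ _) _; rewrite geq_max (leqW hP) andbT.
apply: leq_trans (size_polyMleq _ _) _.
have h : (size ((p.1.+1%:R%:P + p.2.+1%:R%:P * 'X)%R : {poly R[i]}) <= 2)%N.
  apply: leq_trans (size_polyD _ _) _; rewrite geq_max; apply/andP; split.
    exact: leqW (size_polyC_leq1 _).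
  apply: leq_trans (size_polyMleq _ _) _; rewrite size_polyX addn2 /=.
  exact: size_polyC_leq1.
by rewrite -subn1 leq_subLR (leq_trans (leq_add h hQ)).
Qed.

Lemma normc_prod (I : Type) (r : seq I) (F : I -> R[i]) :
  normc (\prod_(i <- r) F i) = \prod_(i <- r) normc (F i).
Proof. by apply: (big_morph _ (@normcM R) (normc1 R)). Qed.

Lemma circle_roots (r : R) N : 0 < r -> (0 < N)%N -> exists rs : seq R[i],
  [/\ 'X^N - ((r ^+ N)%:C%C)%:P = \prod_(z <- rs) ('X - z%:P), size rs = N,
      (r%:C%C) \in rs & forall z, z \in rs -> normc z = r].
Proof.
move=> r0 N0; have [rs] := closed_field_poly_normal ('X^N - ((r ^+ N)%:C%C)%:P : {poly R[i]}).
rewrite lead_coefXnsubC // scale1r => E; exists rs.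
have rootE z : (z \in rs) = (z ^+ N == (r ^+ N)%:C%C).
  by rewrite -root_prod_XsubC -E /root !hornerE subr_eq0.
split => //.
- by have := size_XnsubC ((r ^+ N)%:C%C : R[i]) N0; rewrite E size_prod_XsubC => -[].
- by rewrite rootE rmorphXn.
move=> z; rewrite rootE => /eqP /(congr1 (@normc R)).
rewrite normcX normc_real (ger0_norm (exprn_ge0 _ (ltW r0))) => /eqP.
by rewrite eqrXn2 ?normc_ge0 ?(ltW r0) // => /eqP.
Qed.

(** Factor [q] over its roots y. The product over the circle points is |(y - c)^N - r^N| <= |y -
    c|^N (1 + 2^(-N)), since |y - c| > 2 r; there are at most n roots. *)
Lemma poly_mean (q : {poly R[i]}) c (r : R) N rs n : 0 < r -> (0 < N)%N ->
  (size q <= n.+1)%N ->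
  (forall z, normc (z - c) <= 2 * r -> q.[z] != 0) ->
  'X^N - ((r ^+ N)%:C%C)%:P = \prod_(z <- rs) ('X - z%:P) -> size rs = N ->
  \prod_(z <- rs) normc q.[c + z] <= normc q.[c] ^+ N * (1 + (2 ^+ N)^-1) ^+ n.
Proof.
move=> r0 N0 sq qn0 E srs; have [ss Eq] := closed_field_poly_normal q.
set a := lead_coef q in Eq.
have q0 : q != 0.
  apply/eqP => q0; have := qn0 c; rewrite subrr normc_0 => /(_ _)/eqP; apply.
    by rewrite mulr_ge0 // ltW.
  by rewrite q0 horner0.
have a0 : a != 0 by rewrite lead_coef_eq0.
have sss : (size ss <= n)%N.
  by move: sq; rewrite Eq size_scale // size_prod_XsubC ltnS.
have ev z : normc q.[z] = normc a * \prod_(y <- ss) normc (z - y).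
  rewrite Eq hornerZ normcM horner_prod normc_prod; congr (_ * _).
  by apply: eq_bigr => y _; rewrite !hornerE.
have hss y : y \in ss -> 2 * r < normc (y - c).
  move=> yss; rewrite ltNge; apply/negP => /qn0; apply/negP; rewrite negbK.
  rewrite Eq hornerZ mulf_eq0 (negbTE a0) /= -/(root _ _) root_prod_XsubC //.
under eq_bigr do rewrite ev.
rewrite ev big_split /= big_const_seq count_predT srs iter_mulr_1 exprMn -mulrA.
rewrite ler_wpM2l ?exprn_ge0 ?normc_ge0 // exchange_big /= -prodrXl.
have e1 : 1 <= 1 + (2 ^+ N)^-1 :> R by rewrite lerDl invr_ge0 exprn_ge0.
apply: (@le_trans _ _ (\prod_(y <- ss) (normc (c - y) ^+ N) * (1 + (2 ^+ N)^-1) ^+ size ss)); last first.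
  rewrite ler_wpM2l ?prodr_ge0 // => [y _|]; first by rewrite exprn_ge0 ?normc_ge0.
  by rewrite ler_weXn2l.
have -> : (1 + (2 ^+ N)^-1) ^+ size ss = \prod_(y <- ss) (1 + (2 ^+ N)^-1) :> R.
  by rewrite big_const_seq count_predT iter_mulr_1.
rewrite -big_split /=.
rewrite big_seq [leRHS]big_seq; apply: ler_prod => y /hss hy; apply/andP; split.
  by apply: prodr_ge0 => z _; apply: normc_ge0.
have -> : \prod_(z <- rs) normc (c + z - y) = normc ((y - c) ^+ N - (r ^+ N)%:C%C).
  have -> : (y - c) ^+ N - (r ^+ N)%:C%C = \prod_(z <- rs) ((y - c) - z).
    have := congr1 (fun p : {poly R[i]} => p.[y - c]) E.
    rewrite horner_prod !hornerE => ->; apply: eq_bigr => z _; by rewrite !hornerE.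
  rewrite normc_prod; apply: eq_bigr => z _; rewrite normc_distC; congr normc.
  by rewrite opprD addrA.
apply: le_trans (le_normcD _ _) _.
rewrite normcN normcX normc_real (ger0_norm (exprn_ge0 _ (ltW r0))).
rewrite (normc_distC c) mulrDr mulr1 lerD2l ler_pdivlMr ?exprn_gt0 //.
rewrite -exprMn lerXn2r ?nnegrE ?mulr_ge0 ?normc_ge0 ?(ltW r0) //.
by rewrite mulrC ltW.
Qed.

Definition disc_in c (r : R) := forall z, normc (z - c) <= r -> A0 z.

(** Logarithm of [poly_mean] for the denominators; the factor 2 undoes the halving in exp (ell /
    2). *)
Lemma ell_mean c (r : R) N rs w : 0 < r -> (0 < N)%N -> disc_in c (2 * r) ->
  'X^N - ((r ^+ N)%:C%C)%:P = \prod_(z <- rs) ('X - z%:P) -> size rs = N ->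
  (forall z, z \in rs -> normc z = r) ->
  \sum_(z <- rs) ell (c + z) w 0 <= N%:R * ell c w 0 + 2 * (size w)%:R / 2 ^+ N.
Proof.
move=> r0 N0 disc E srs hrs.
have cA : A0 c by apply: disc; rewrite subrr normc_0 mulr_ge0 // ltW.
have h z : z \in rs -> A0 (c + z).
  move=> /hrs hz; apply: disc; rewrite addrC addKr hz; lra.
have := poly_mean r0 N0 (size_convergent w).2 _ E srs.
move=> /(_ c) hmean.
have {}hmean := hmean (fun z hz => let: And3 q _ _ := convergentP w (disc z hz) in q).
have [_ _ Ec] := convergentP w cA.
move: hmean; rewrite Ec big_seq.
under eq_bigr => z /h zA do (have [_ _ ->] := convergentP w zA).
rewrite -big_seq -expR_sum -expRM_natl => hmean.
have h1 : (1 + (2 ^+ N)^-1) ^+ size w <= expR ((size w)%:R * (2 ^+ N)^-1) :> R.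
  rewrite expRM_natl lerXn2r ?nnegrE ?expR_ge0 ?addr_ge0 ?invr_ge0 ?exprn_ge0 //.
  exact: expR_ge1Dx.
have := le_trans hmean (ler_wpM2l (expR_ge0 _) h1).
rewrite -expRD ler_expR -mulr_suml; lra.
Qed.

Lemma expR_jensen (ys : seq R) : (0 < size ys)%N ->
  (size ys)%:R * expR ((\sum_(y <- ys) y) / (size ys)%:R) <= \sum_(y <- ys) expR y.
Proof.
move=> s0; set N : R := (size ys)%:R; set m := _ / N.
have N0 : 0 < N by rewrite ltr0n.
(* The tangent line of exp at the mean [m] lies below the graph, and its linear part averages to
   0. *)
apply: (@le_trans _ _ (\sum_(y <- ys) (expR m * (1 + (y - m))))).
  have cst (k : R) : \sum_(y <- ys) k = k * N.
    by rewrite big_const_seq count_predT iter_addr addr0 mulr_natr.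
  rewrite -mulr_sumr big_split sumrB /= !cst.
  have -> : \sum_(y <- ys) y = m * N by rewrite /m mulfVK // gt_eqF.
  by rewrite mul1r subrr addr0 mulrC.
apply: ler_sum => y _; apply: (@le_trans _ _ (expR m * expR (y - m))).
  by rewrite ler_wpM2l ?expR_ge0 // expR_ge1Dx.
by rewrite -expRD addrC subrK.
Qed.

(* The weights exp (a (N - 1)) and exp (- a) (N - 1 times) have product 1, so
   they do not affect the geometric mean; they let a small Z at c + r
   compensate larger values elsewhere on the circle. *)
Lemma Z_mean c (r : R) N rs L n (s a : R) : 0 < r -> (0 < N)%N -> 0 <= s ->
  disc_in c (2 * r) ->
  'X^N - ((r ^+ N)%:C%C)%:P = \prod_(z <- rs) ('X - z%:P) -> size rs = N ->
  (r%:C%C) \in rs -> (forall z, z \in rs -> normc z = r) ->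
  N%:R * Z c L n s <= expR (2 * s * n%:R / (N%:R * 2 ^+ N)) *
    (expR (a * (N%:R - 1)) * Z (c + r%:C%C) L n s +
     \sum_(z <- rem r%:C%C rs) expR (- a) * Z (c + z) L n s).
Proof.
move=> r0 N0 s0 disc E srs rrs hrs.
have N1 : 0 < N%:R :> R by rewrite ltr0n.
rewrite /Z mulr_sumr.
have -> : \sum_(z <- rem r%:C%C rs) expR (- a) * Z (c + z) L n s =
    \sum_(w <- words (box L) n) \sum_(z <- rem r%:C%C rs) expR (- a - s * ell (c + z) w 0).
  rewrite exchange_big /=; apply: eq_bigr => z _; rewrite /Z mulr_sumr.
  by apply: eq_bigr => w _; rewrite -expRD.
rewrite mulr_sumr -big_split mulr_sumr /=; apply: ler_sum_words => w sw.
have hm := ell_mean w r0 N0 disc E srs hrs; rewrite sw (big_rem _ rrs) /= in hm.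
pose ys := (a * (N%:R - 1) - s * ell (c + r%:C%C) w 0) ::
   [seq - a - s * ell (c + z) w 0 | z <- rem r%:C%C rs].
have sys : size ys = N by rewrite /= size_map size_rem // srs prednK.
have := @expR_jensen ys; rewrite sys => /(_ N0).
rewrite /ys !big_cons !big_map /= expRD.
have -> : a * (N%:R - 1) - s * ell (c + r%:C%C) w 0 +
   \sum_(z <- rem r%:C%C rs) (- a - s * ell (c + z) w 0) =
   - s * (ell (c + r%:C%C) w 0 + \sum_(z <- rem r%:C%C rs) ell (c + z) w 0).
  rewrite sumrB big_const_seq count_predT iter_addr addr0 size_rem // srs -mulr_sumr.
  have EN : N.-1%:R = N%:R - 1 :> R by rewrite -subn1 natrB.
  rewrite -[- a *+ _]mulr_natr EN; ring.
move=> hj; apply: le_trans (ler_wpM2l (expR_ge0 _) hj).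
rewrite mulrCA ler_pM2l // -expRD ler_expR.
move: hm; set S := _ + \sum_(z <- _) _ => hm.
have : - s * (N%:R * ell c w 0 + 2 * n%:R / 2 ^+ N) / N%:R <= - s * S / N%:R.
  by rewrite ler_pM2r ?invr_gt0 // !mulNr lerN2 ler_wpM2l.
have -> : - s * (N%:R * ell c w 0 + 2 * n%:R / 2 ^+ N) / N%:R =
   - (s * ell c w 0) - 2 * s * n%:R / (N%:R * 2 ^+ N).
  field; by rewrite !pnatr_eq0 -?lt0n ?N0 ?expf_neq0 ?pnatr_eq0.
lra.
Qed.

End MeanValue.

(** * The dimension function *)

Section Dimension.
Variable R : realType.
Implicit Types (c z tau : R[i]) (s t : R).

Lemma h_ge0 tau : (0 <= h tau)%E.
Proof. by apply: le_ereal_inf_tmp => _ [s [s0 _] <-]; rewrite lee_fin. Qed.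

Lemma Z_lt tau L n s : A0 tau -> (0 < n)%N -> 0 < s -> (h tau < s%:E)%E ->
  Z tau L n s < expR (10 * s).
Proof.
move=> tA n0 s0 hlt; rewrite ltNge; apply/negP => hZ.
by move: hlt; apply/negP; rewrite -leNgt; apply: h_ge hZ.
Qed.

Lemma Z_gt tau n s C : A0 tau -> (0 < n)%N -> 0 <= s -> (s%:E < h tau)%E ->
  C * expR (10 * s) < 1 -> exists L, C < Z tau L n s.
Proof.
move=> tA n0 s0 hlt hC; apply: contrapT => hno; move: hlt; apply/negP; rewrite -leNgt.
by apply: (h_le tA s0 n0 _ hC) => L; rewrite leNgt; apply/negP => ?; apply: hno; exists L.
Qed.

Lemma nat_ge (a : R) : exists n, (0 < n)%N /\ a <= n%:R.
Proof. by exists (Num.trunc a).+1; split => //; apply/ltW/truncnS_gt. Qed.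

Lemma A0_norm_ge1 tau : A0 tau -> 1 <= normc tau.
Proof. by case=> _ h; exact: le_trans h (le_trans (ler_norm _) (ler_normIm _)). Qed.

Lemma Z_bounded_exp s : 1 < s -> exists2 b, 0 <= b & forall tau L n, A0 tau ->
  Z tau L n s <= expR (n%:R * b).
Proof.
move=> s1; have [B B0 hB] := Z_bounded s1.
exists (Num.max (ln B) 0) => [|tau L n tA]; first by rewrite le_max lexx orbT.
apply: le_trans (hB tau L n tA) _; rewrite expRM_natl lerXn2r ?nnegrE ?expR_ge0 //.
  by rewrite mulr_ge0 ?expR_ge0 // ltW.
apply: (@le_trans _ _ B).
  rewrite ler_piMr ?(ltW B0) // expR_le1 oppr_le0 mulr_ge0 ?(ltW (lt_trans ltr01 s1)) //.
  by rewrite ln_ge0 // A0_norm_ge1.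
by rewrite -[leLHS]lnK ?posrE // ler_expR le_max lexx.
Qed.

Lemma h_bounded : exists2 S : R, 0 < S & forall tau, A0 tau -> (h tau <= S%:E)%E.
Proof.
have [b b0 hb] := Z_bounded_exp (ltr1n _ 2 : 1 < 2).
(* By [Z_shift], raising the exponent by t gains exp (- n t / 5) = exp (- n (b + 1)), against a
   growth of at most exp (n b). *)
pose t := 5 * (b + 1); have t0 : 0 < t by rewrite mulr_gt0 // ltr_wpDl.
have [n [n0 hn]] := nat_ge (10 * (2 + t) + 1).
exists (2 + t) => [|tau tA]; first by rewrite addr_gt0.
have hZ L : Z tau L n (2 + t) <= expR (- n%:R).
  apply: le_trans (Z_shift _ _ _ tA (ltW t0)) _.
  apply: le_trans (ler_wpM2l (expR_ge0 _) (hb tau L n tA)) _.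
  rewrite -expRD ler_expR /t; lra.
apply: (h_le tA _ n0 hZ); first by rewrite addr_ge0 // ltW.
by rewrite -expRD expR_lt1; lra.
Qed.

Lemma h_at_infinity s : 1 < s -> exists T : R, forall tau, A0 tau -> T <= normc tau ->
  (h tau <= s%:E)%E.
Proof.
move=> s1; have [B B0 hB] := Z_bounded s1.
have s0 : 0 < s by apply: lt_trans s1.
(* One-letter words suffice in [h_le], as |tau|^(-s) <= 1 / |tau|; the factor 2 makes the inequality
   strict. *)
exists (2 * B * expR (10 * s)) => tau tA hT.
have n1 := A0_norm_ge1 tA; have n0 : 0 < normc tau by apply: lt_le_trans n1.
apply: (@h_le _ _ _ 1 (B * expR (- (s * ln (normc tau)))) tA (ltW s0)) => // [L|].
  by have := hB tau L 1 tA; rewrite expr1.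
have : expR (- (s * ln (normc tau))) <= (normc tau)^-1.
  rewrite -[X in _ <= X^-1]lnK ?posrE // -expRN ler_expR lerN2.
  by rewrite ler_peMl ?(ltW s1) // ln_ge0.
have := expR_gt0 (10 * s) => E0 hE.
apply: (@le_lt_trans _ _ (B * (normc tau)^-1 * expR (10 * s))).
  by rewrite ler_pM2r // ler_pM2l.
rewrite mulrAC ltr_pdivrMr // mul1r; apply: lt_le_trans hT.
by rewrite -mulrA ltr_pMl ?mulr_gt0 // ltr1n.
Qed.

Lemma h_gt1 : exists2 s, 1 < s & (s%:E <= h ((0%R +i* 1%R)%C : R[i]))%E.
Proof.
have [s [L [s1 tA hZ]]] := Z_large R.
by exists s => //; apply: (h_ge tA _ _ hZ) => //; apply: lt_trans s1.
Qed.

Lemma h_fin tau : A0 tau -> h tau \is a fin_num.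
Proof.
move=> tA; have [S _ hS] := h_bounded; rewrite ge0_fin_numE ?h_ge0 //.
by apply: le_lt_trans (hS _ tA) _; rewrite ltry.
Qed.

Lemma h_uniform_continuity t : 0 < t -> exists2 e, 0 < e &
  forall tau tau', A0 tau -> A0 tau' -> normc (tau - tau') <= e ->
  (h tau' <= h tau + t%:E)%E.
Proof.
move=> t0; have [S S0 hS] := h_bounded.
have q0 : 0 < t / (S + t) by rewrite divr_gt0 // addr_gt0.
(* The change of parameter costs at most exp (24 n t / 480) = exp (n t / 20), while raising the
   exponent by t / 2 gains exp (- n t / 10). *)
exists (t / (S + t) / 480) => [|tau tau' tA tA' d]; first by lra.
have := hS _ tA; have := h_ge0 tau; have := h_fin tA.
rewrite fin_numE => /andP[]; case E : (h tau) => [a| |] // _ _.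
rewrite !lee_fin => a0 aS.
set s := a + t / 2; have s0 : 0 < s by rewrite /s; lra.
have has : (h tau < s%:E)%E by rewrite E lte_fin /s; lra.
have [n [n0 hn]] := nat_ge ((20 * s + 5 * t + 1) * 20 / t).
have -> : (a%:E + t%:E)%E = (s + t / 2)%:E by rewrite -EFinD; congr EFin; rewrite /s; lra.
apply: (@h_le _ _ _ n (expR (- (10 * s + 5 * t + 1))) tA' _ n0); first by lra.
  move=> L; have t2 : 0 <= t / 2 by lra.
  apply: le_trans (Z_shift _ _ _ tA' t2) _.
  apply: le_trans (ler_wpM2l (expR_ge0 _) (Z_param _ _ tA tA' (ltW s0))) _.
  apply: le_trans (ler_wpM2l (expR_ge0 _) (ler_wpM2l (expR_ge0 _) (ltW (Z_lt L tA n0 s0 has)))) _.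
  rewrite -!expRD ler_expR.
  have h1 : normc (tau - tau') * s <= t / 480.
    apply: (@le_trans _ _ (t / (S + t) / 480 * (S + t))).
      apply: ler_pM; [exact: normc_ge0|exact: ltW|exact: d|rewrite /s; lra].
    by rewrite mulrAC mulfVK // gt_eqF // addr_gt0.
  have h2 : 20 * s + 5 * t + 1 <= n%:R * t / 20.
    by rewrite ler_pdivlMr // -ler_pdivrMr.
  have n00 : 0 <= n%:R :> R by [].
  have h3 := ler_wpM2l n00 h1.
  move: h2 h3; move: (n%:R : R) (normc _) => k d' h2 h3.
  rewrite (_ : 24 * k * d' * s = 24 * (k * (d' * s))); last by ring.
  lra.
rewrite -expRD expR_lt1; lra.
Qed.

Lemma h_max_exists : exists tau, is_max_point (@h R) A0 tau.
Proof.
have [s s1 hs] := h_gt1; have [T hT] := h_at_infinity s1.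
(* Folding the whole plane onto A0 gives a function on R * R, to which compactness of a square
   applies directly. *)
pose P (x : R * R) : R[i] := (`|x.1| +i* (1 + `|x.2|))%C.
have PA x : A0 (P x) by split => /=; rewrite ?lerDl.
pose f x := fine (h (P x)).
have Ef x : h (P x) = (f x)%:E by rewrite /f fineK // h_fin.
have fcont : continuous f.
  move=> x; apply/cvgrPdist_le => e e0.
  have [d d0 hd] := h_uniform_continuity e0.
  have hP (y z : R * R) : `|y.1 - z.1| <= d / 2 -> `|y.2 - z.2| <= d / 2 -> f z <= f y + e.
    move=> h1 h2; rewrite -lee_fin EFinD -!Ef; apply: hd; [exact: PA|exact: PA|].
    apply: le_trans (normc_le_sum _) _; rewrite /P /=.
    have := ler_dist_dist y.1 z.1; have := ler_dist_dist y.2 z.2.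
    rewrite opprD addrACA subrr add0r; lra.
  near=> y; rewrite ler_distl.
  have : `|x.1 - y.1| <= d / 2 /\ `|x.2 - y.2| <= d / 2.
    near: y; exists (ball x.1 (d / 2), ball x.2 (d / 2)) => /=.
      by split; apply: nbhsx_ballx; rewrite divr_gt0.
    by move=> y [/= h1 h2]; split; apply: ltW.
  move=> [h1 h2]; apply/andP; split; first by rewrite lerBlDr; apply: hP.
  by apply: hP; rewrite distrC.
pose T' := Num.max T 0.
have T'0 : 0 <= T' by rewrite le_max lexx orbT.
pose K := `[0, T'] `*` `[0, T'] : set (R * R).
have K00 : K (0, 0) by split; rewrite /= in_itv /= lexx T'0.
have [||| x xK hmax] := @compact_EVT_max _ R f K.
- by exists (0, 0).
- by apply: compact_setX; apply: segment_compact.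
- exact: continuous_subspaceT.
exists (P x); split; first exact: PA.
move=> tau tA.
(* The corner of the square is tau = i, where h is at least s; far away h is at most s. *)
have E0 : P (0, 0) = (0 +i* 1)%C by rewrite /P /= normr0 addr0.
have [hlarge|hsmall] := lerP T (normc tau).
  apply: le_trans (hT _ tA hlarge) _; apply: le_trans hs _.
  by rewrite -E0 !Ef lee_fin; apply: hmax; rewrite inE.
have [u0 v1] := tA.
have -> : tau = P (complex.Re tau, complex.Im tau - 1).
  rewrite /P /= !ger0_norm ?subr_ge0 // addrC subrK; by case: (tau).
rewrite !Ef lee_fin; apply: hmax; rewrite inE; split; rewrite /= in_itv /= ?u0 ?subr_ge0 ?v1 /=.
  rewrite le_max (le_trans (le_trans (ler_norm _) (ler_normRe _)) (ltW hsmall)) //.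
rewrite le_max lerBlDr (le_trans (le_trans (ler_norm _) (ler_normIm _))) //.
by apply: le_trans (ltW hsmall) _; rewrite lerDl.
Unshelve. all: by end_near.
Qed.

(** * The maximum principle *)

Section MaximumPrinciple.
Variables (M : R).
Hypotheses (M_gt1 : 1 < M) (h_leM : forall tau, A0 tau -> (h tau <= M%:E)%E).

(* If h (c + r) < M, then Z at c + r decays like exp (- n alpha) at exponents s
   close to M.  N is chosen first, so that
   the mean value error 2 s / 2 ^ N is below alpha, then eta = M - s, so that
   the growth exp (2 eta g n) on the rest of the circle is negligible against
   exp (- n alpha / N), and n last. *)
Lemma h_max_propagates c r : 0 < r -> disc_in c (2 * r) -> h c = M%:E ->
  h (c + r%:C%C) = M%:E.
Proof.
move=> r0 disc hc.
have cA : A0 c by apply: disc; rewrite subrr normc_0 mulr_ge0 // ltW.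
have crA z : normc z = r -> A0 (c + z).
  move=> hz; apply: disc; rewrite addrC addKr hz; lra.
have rr : normc r%:C%C = r by rewrite normc_real ger0_norm // ltW.
apply/eqP; rewrite eq_le (h_leM (crA _ rr)) /= leNgt; apply/negP => hlt.
have M1 := M_gt1.
have [s0 [s01 hs0 s0M]] : exists s0 : R, [/\ 1 < s0, (h (c + r%:C%C)%R < s0%:E)%E & s0 < M].
  have := h_fin (crA _ rr); rewrite fin_numE => /andP[].
  move: hlt; case: (h _) => [a| |] // + _ _; rewrite lte_fin => aM.
  exists ((Num.max 1 a + M) / 2); have : Num.max 1 a < M by rewrite gt_max M_gt1.
  have : 1 <= Num.max 1 a by rewrite le_max lexx.
  have : a <= Num.max 1 a by rewrite le_max lexx orbT.
  by rewrite lte_fin; move: (Num.max _ _) => m ? ? ?; split; lra.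
have [b b0 hZb] := Z_bounded_exp s01.
have [D D0 ED] : exists2 D, 0 < D & 2 * D = M - s0.
  by exists ((M - s0) / 2); lra.
(* An exponent shift of at least D yields a decay of at least exp (- n D / 5) in [Z_shift]. *)
have [alpha alpha0 Ealpha] : exists2 alpha, 0 < alpha & 5 * alpha = D.
  by exists (D / 5); lra.
(* The cut-off n g makes the term at s0 at most 1 in [Z_interpolate], because g (s - s0) >= b. *)
have [g g0 gD] : exists2 g, 0 <= g & g * D = b.
  by exists (b / D); [rewrite divr_ge0 // ltW|rewrite mulfVK // gt_eqF].
have [N [N0 hN]] : exists N, (0 < N)%N /\ 2 * M / 2 ^+ N <= alpha / 4.
  have [N hN] : exists N, forall j, (N <= j)%N -> (2^-1 : R) ^+ j <= alpha / (8 * M).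
    apply: expn_small; last by rewrite divr_gt0 // mulr_gt0 // (lt_trans _ M_gt1).
    by apply/andP; split; lra.
  exists N.+1; split => //; have := hN N.+1 (leqnSn N); rewrite exprVn.
  rewrite ler_pdivlMr ?mulr_gt0 ?(lt_trans _ M_gt1) //; move: (_^-1) => q; lra.
have N1 : 1 <= N%:R :> R by rewrite ler1n.
have [eta [eta0 etaD eta1 etag]] : exists eta,
    [/\ 0 < eta, eta <= D, eta <= 1 & 2 * eta * g * N%:R <= alpha / 4].
  exists (Num.min (Num.min D 1) (alpha / (8 * (g + 1) * N%:R))).
  have q0 : 0 < alpha / (8 * (g + 1) * N%:R).
    by rewrite divr_gt0 // !mulr_gt0 ?ltr_wpDl // (lt_le_trans _ N1).
  split.
  - by rewrite !lt_min D0 ltr01.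
  - by rewrite !ge_min lexx.
  - by rewrite !ge_min lexx orbT.
  apply: (@le_trans _ _ (2 * (alpha / (8 * (g + 1) * N%:R)) * (g + 1) * N%:R)).
    rewrite ler_pM2r ?(lt_le_trans _ N1) //.
    apply: ler_pM => //; first by rewrite mulr_ge0 // ltW // !lt_min D0 ltr01.
      by rewrite ler_pM2l // !ge_min lexx !orbT.
    by rewrite lerDl.
  rewrite le_eqVlt; apply/orP; left; apply/eqP; field.
  by rewrite !gt_eqF ?ltr_wpDl // (lt_le_trans _ N1).
pose s := M - eta; pose s1 := M + eta.
have sD : D <= s - s0 by rewrite /s; lra.
have s_gt0 : 0 < s by lra.
have Zother tau L n : A0 tau -> (0 < n)%N ->
    Z tau L n s <= 2 * expR (10 * (M + 1)) * expR (n%:R * (g * (2 * eta))).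
  move=> tA n0.
  have hs1 : (h tau < s1%:E)%E by apply: le_lt_trans (h_leM tA) _; rewrite lte_fin /s1; lra.
  have h1 : s0 <= s by lra.
  have h2 : s <= s1 by rewrite /s /s1; lra.
  apply: le_trans (Z_interpolate tau L n (n%:R * g) h1 h2) _.
  have n00 : 0 <= n%:R :> R by [].
  have e1 : expR (- (n%:R * g * (s - s0))) * Z tau L n s0 <= 1.
    apply: le_trans (ler_wpM2l (expR_ge0 _) (hZb tau L n tA)) _.
    rewrite -expRD expR_le1 -mulrA addrC -mulrBr pmulr_rle0 ?ltr0n // subr_le0 -gD.
    by rewrite ler_wpM2l.
  have s10 : 0 < s1 by rewrite /s1; lra.
  have e2 : expR (n%:R * g * (s1 - s)) * Z tau L n s1 <=
      expR (10 * (M + 1)) * expR (n%:R * (g * (2 * eta))).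
    apply: le_trans (ler_wpM2l (expR_ge0 _) (ltW (Z_lt L tA n0 s10 hs1))) _.
    rewrite mulrC ler_pM ?expR_ge0 // ler_expR /s1 ?/s; first by lra.
    by rewrite -mulrA ler_wpM2l // ler_wpM2l //; lra.
  have : 1 <= expR (10 * (M + 1)) * expR (n%:R * (g * (2 * eta))).
    rewrite -expRD -[leLHS]expR0 ler_expR.
    have : 0 <= n%:R * (g * (2 * eta)).
      by apply: mulr_ge0 => //; apply: mulr_ge0 => //; lra.
    lra.
  move=> e3; apply: le_trans (lerD e1 e2) _.
  by rewrite -mulrA [leRHS]mulr_natl mulr2n lerD2r.
have Zr L n : (0 < n)%N -> Z (c + r%:C%C) L n s <= expR (10 * (M + 1)) * expR (- (n%:R * alpha)).
  move=> n0; have E : s = s0 + (s - s0) by rewrite addrC subrK.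
  rewrite E; apply: le_trans (Z_shift _ _ _ (crA _ rr) (le_trans (ltW D0) sD)) _.
  have s00 : 0 < s0 by apply: lt_trans s01.
  apply: le_trans (ler_wpM2l (expR_ge0 _) (ltW (Z_lt L (crA _ rr) n0 s00 hs0))) _.
  rewrite mulrC ler_pM ?expR_ge0 // ler_expR; first by lra.
  rewrite lerN2 -mulrA ler_wpM2l //; lra.
have [rs [Ers srs rrs hrs]] := circle_roots r0 N0.
pose K1 := 2 * expR (10 * (M + 1)); have K10 : 0 < K1 by rewrite mulr_gt0 ?expR_gt0.
have Zc L n : (0 < n)%N -> Z c L n s <= K1 * expR (- (n%:R / N%:R * (alpha / 2))).
  move=> n0; have Ngt : 0 < N%:R :> R by rewrite ltr0n.
  (* This choice equalizes the rates: a (N - 1) - n alpha = - a. The two errors of alpha / 4 then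
     leave the rate alpha / 2. *)
  pose a := n%:R / N%:R * alpha.
  have n00 : 0 <= n%:R / N%:R :> R by rewrite divr_ge0.
  have := Z_mean L n a r0 N0 (ltW s_gt0) disc Ers srs rrs hrs.
  set E := expR (2 * s * _ / _).
  set Q := K1 * expR (- a + n%:R * (g * (2 * eta))).
  have t1 : expR (a * (N%:R - 1)) * Z (c + r%:C%C) L n s <= Q.
    apply: le_trans (ler_wpM2l (expR_ge0 _) (Zr L n n0)) _.
    have -> : Q = expR (10 * (M + 1)) * (2 * expR (- a + n%:R * (g * (2 * eta)))).
      by rewrite /Q /K1; ring.
    rewrite mulrCA ler_pM2l ?expR_gt0 // -expRD.
    have -> : a * (N%:R - 1) - n%:R * alpha = - a by rewrite /a; field; rewrite gt_eqF.
    apply: (@le_trans _ _ (expR (- a + n%:R * (g * (2 * eta))))).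
      rewrite ler_expR lerDl; apply: mulr_ge0 => //; apply: mulr_ge0 => //; lra.
    by rewrite ler_peMl ?expR_ge0 // ler1n.
  have t2 : \sum_(z <- rem r%:C%C rs) expR (- a) * Z (c + z) L n s <= (N%:R - 1) * Q.
    apply: (@le_trans _ _ (\sum_(z <- rem r%:C%C rs) Q)).
      rewrite big_seq [leRHS]big_seq; apply: ler_sum => z /mem_rem /hrs hz.
      apply: le_trans (ler_wpM2l (expR_ge0 _) (Zother _ L n (crA _ hz) n0)) _.
      by rewrite /Q expRD mulrCA.
    rewrite big_const_seq count_predT iter_addr addr0 size_rem // srs -[_ *+ _]mulr_natl.
    by rewrite -subn1 natrB.
  move=> hm; have {}hm : N%:R * Z c L n s <= N%:R * (E * Q).
    apply: le_trans hm _; rewrite mulrCA ler_wpM2l ?expR_ge0 //; lra.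
  rewrite ler_pM2l // in hm; apply: le_trans hm _.
  rewrite /Q mulrCA ler_pM2l // /E -expRD ler_expR.
  have -> : 2 * s * n%:R / (N%:R * 2 ^+ N) = n%:R / N%:R * (2 * s / 2 ^+ N).
    by field; rewrite expf_neq0 ?gt_eqF.
  have -> : n%:R * (g * (2 * eta)) = n%:R / N%:R * (2 * eta * g * N%:R).
    by field; rewrite gt_eqF.
  rewrite /a -!mulrN -!mulrDr ler_wpM2l //.
  have : 2 * s / 2 ^+ N <= 2 * M / 2 ^+ N.
    by rewrite ler_pM2r ?invr_gt0 ?exprn_gt0 // ler_pM2l // /s; lra.
  lra.
have hcs : (s%:E < h c)%E by rewrite hc lte_fin /s; lra.
(* The factor 1/2 makes C exp (10 s) strictly less than 1; [n] is then chosen so that the decay at c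
   falls below C. *)
pose C := expR (- (10 * s)) / 2.
have [n [n0 hn]] := nat_ge (- ln (C / K1) / (alpha / 2) * N%:R).
have C0 : 0 < C by rewrite divr_gt0 ?expR_gt0.
have [L hL] : exists L, C < Z c L n s.
  apply: Z_gt => //; first exact: ltW.
  by rewrite /C mulrAC -expRD addrC subrr expR0; lra.
move: hL; apply/negP; rewrite -leNgt; apply: le_trans (Zc L n n0) _.
have CK : 0 < C / K1 by apply: divr_gt0.
rewrite mulrC -ler_pdivlMr // -[X in _ <= X](lnK CK) ler_expR lerNl.
by rewrite -ler_pdivrMr ?divr_gt0 // ler_pdivlMr // ltr0n.
Qed.

(** A0 is stable under translation to the right, so one radius serves at every step of the
    iteration. *)
Lemma disc_in_addr c (a r : R) : 0 <= a -> disc_in c r -> disc_in (c + a%:C%C) r.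
Proof.
move=> a0 disc z hz; have [] := disc (z - a%:C%C).
  by rewrite -addrA -opprD [(_)%:C%C + _]addrC.
rewrite !ReImE /= oppr0 addr0 => h1 h2; split => //; apply: le_trans h1 _.
by rewrite gerBl.
Qed.

Lemma h_lt_max_interior c r : 0 < r -> disc_in c (2 * r) -> h c <> M%:E.
Proof.
move=> r0 disc hc.
have dk k : disc_in (c + (k%:R * r)%:C%C) (2 * r).
  by apply: disc_in_addr => //; rewrite mulr_ge0 // ltW.
have hk k : h (c + (k%:R * r)%:C%C) = M%:E.
  elim: k => [|k IH]; first by rewrite mul0r addr0.
  have := h_max_propagates r0 (dk k) IH; rewrite -addrA -rmorphD /=.
  by rewrite -[X in _ * r + X]mul1r -mulrDl natr1.
have M1 := M_gt1; have m1 : 1 < (1 + M) / 2 by lra.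
have [T hT] := h_at_infinity m1.
have [k [_ hkT]] := nat_ge (T / r).
have kA : A0 (c + (k%:R * r)%:C%C).
  by apply: (dk k); rewrite subrr normc_0 mulr_ge0 // ltW.
have := hT _ kA; rewrite hk lee_fin => /(_ _) h1.
have : M <= (1 + M) / 2.
  apply: h1; apply: le_trans (ge_Re_normc _); rewrite ReD /=.
  have [c0 _] : A0 c by apply: disc; rewrite subrr normc_0 mulr_ge0 // ltW.
  by rewrite ler_wpDl // -ler_pdivrMr.
lra.
Qed.

End MaximumPrinciple.

(** * From topology to discs *)

Lemma boundary_A0 (tau : R[i]) : boundary A0 tau -> A0 tau.
Proof.
move=> [hcl _]; have hball (e : R) : 0 < e -> exists z, A0 z /\ normc (tau - z) < e.
  move=> e0; have [|z [zA hz]] := hcl (ball (tau : R[i]^o) e%:C%C).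
    by apply: nbhsx_ballx; rewrite ltcR.
  by exists z; split => //; move: hz; rewrite /ball /= ltcR.
split; rewrite leNgt; apply/negP => hlt.
  have [|z [[z0 _] hz]] := hball (- complex.Re tau); first by rewrite oppr_gt0.
  have := le_lt_trans (le_trans (ler_norm _) (ler_normRe _)) hz.
  rewrite normc_distC in hz; have := le_lt_trans (ge_Re_normc _) hz.
  rewrite ReD ReN; lra.
have [|z [[_ z1] hz]] := hball (1 - complex.Im tau); first by rewrite subr_gt0.
rewrite normc_distC in hz; have := le_lt_trans (le_trans (ler_norm _) (ler_normIm _)) hz.
rewrite ImD ImN; lra.
Qed.

Lemma not_boundary_disc (tau : R[i]) : A0 tau -> ~ boundary A0 tau ->
  exists2 r : R, 0 < r & disc_in tau (2 * r).
Proof.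
move=> tA nb.
have : interior (A0 : set R[i]^o) tau.
  by apply: contrapT => hi; apply: nb; split => //; apply: subset_closure.
(* Positivity of the radius in R[i] forces its imaginary part to vanish. *)
move=> /nbhs_ballP [[e e'] /=]; rewrite ltcE /= => /andP[/eqP -> e0] hb.
exists (e / 3) => [|z hz]; first by rewrite divr_gt0.
apply: hb; rewrite /ball /= -/(e%:C)%C ltcR normc_distC; apply: le_lt_trans hz _; lra.
Qed.

End Dimension.

Theorem corollary1p4 (R : realType) :
  (exists tau : R[i], is_max_point (@h R) A0 tau) /\
  (forall tau : R[i], is_max_point (@h R) A0 tau -> boundary A0 tau) /\
  (exists M : \bar R,
     is_max (@h R @` A0) M /\ is_max (@h R @` boundary A0) M).
Proof.
have [t0 max0] := @h_max_exists R.
have bd (tau : R[i]) : is_max_point (@h R) A0 tau -> boundary A0 tau.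
  move=> [tA tmax]; apply: contrapT => nb.
  have [r r0 disc] := not_boundary_disc tA nb.
  have Eh : h tau = (fine (h tau))%:E by rewrite fineK // h_fin.
  apply: (h_lt_max_interior (M := fine (h tau)) _ _ r0 disc Eh).
    have [s s1 hs] := h_gt1 R; apply: lt_le_trans s1 _; rewrite -lee_fin -Eh.
    by apply: le_trans hs _; apply: tmax; split => /=.
  by move=> z zA; rewrite -Eh; apply: tmax.
split; first by exists t0.
(* The maximizer [t0] lies on the boundary, itself contained in A0, so [h t0] is the maximum over
   both sets. *)
split => //; exists (h t0); have [t0A t0max] := max0.
split; split.
- by exists t0.
- by move=> _ [z zA <-]; apply: t0max.
- by exists t0 => //; apply: bd.
- by move=> _ [z /boundary_A0 zA <-]; apply: t0max.
Qed.
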